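(* Let $k$ be a field and $\overline k$ a separable closure of $k$. Let $Y$ be a geometrically integral $k$-variety with $H^0(Y_{\overline k},\mathcal{O}_{Y_{\overline k}})=\overline k$. Assume that $Y$ admits a Cox ring $R$ over $k$ of type $M\subseteq\operatorname{Pic}(Y_{\overline k})$ for a finitely generated $\operatorname{Gal}(\overline k/k)$-invariant subgroup $M$ of $\operatorname{Pic}(Y_{\overline k})$. Let $X\subseteq Y$ be a closed subvariety such that $X_{\overline k}\subseteq Y_{\overline k}$ is a strict complete intersection with respect to $R_{\overline k}=R\otimes_k\overline k$ of hypersurfaces $H_1,\dots,H_s$ defined by homogeneous elements $f_1,\dots,f_s\in R_{\overline k}$, respectively. Assume that there are integers $0=s_0<s_1<\dots<s_n=s$ such that for every $i\in\{0,\dots,n-1\}$ the set $\{[H_{s_i+1}],\dots,[H_{s_{i+1}}]\}$ forms an orbit of cardinality $s_{i+1}-s_i$ under the $\operatorname{Gal}(\overline k/k)$-action on $\operatorname{Pic}(Y_{\overline k})$. Then $X_{\overline k}\subseteq Y_{\overline k}$ is a complete intersection of hypersurfaces $H_1',\dots,H_s'$ of $Y_{\overline k}$ such that $H'_{s_i+1},\dots,H'_{s_{i+1}}$ form an orbit under the $\operatorname{Gal}(\overline k/k)$-action on $Y_{\overline k}$ for all $i\in\{0,\dots,n-1\}$, and $[H'_i]=[H_i]$ in $\operatorname{Pic}(Y_{\overline k})$ for all $i\in\{1,\dots,s\}$.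
   Context: Conventions. A $k$-variety is a separated scheme of finite type over $k$; a closed subvariety is a closed subscheme (not assumed reduced). A hypersurface $H$ of an integral variety is (the closed subscheme given by) an effective Cartier divisor, with ideal sheaf $\mathscr{I}_H=\mathcal{O}(-H)$ and class $[H]$ in the Picard group. Complete intersection: a closed subvariety $X$ of an integral variety $Y$ is a complete intersection of hypersurfaces $H_1,\dots,H_s$ of $Y$ if $\dim X+s=\dim Y$ and $\mathscr{I}_X=\mathscr{I}_{H_1}+\dots+\mathscr{I}_{H_s}$. Cox rings. Let first $Y'$ be an integral variety over a separably closed field $k'$ with $H^0(Y',\mathcal{O}_{Y'})^\times=k'^\times$, and $M\subseteq\operatorname{Pic}(Y')$ a finitely generated subgroup. A Cox ring of $Y'$ of type $M$ is an $M$-graded $k'$-algebra $R'=\bigoplus_{m\in M}R'_m$ of the form $R'_m=H^0(Y',\mathcal{L}_m)$, where $\bigoplus_{m\in M}\mathcal{L}_m$ is an $M$-graded commutative $\mathcal{O}_{Y'}$-algebra with $\mathcal{L}_0=\mathcal{O}_{Y'}$, each $\mathcal{L}_m$ is an invertible sheaf of class $m$, and all multiplication maps $\mathcal{L}_m\otimes\mathcal{L}_{m'}\to\mathcal{L}_{m+m'}$ are isomorphisms. Every nonzero homogeneous $f\in R'_m$ defines an effective Cartier divisor $D_f$ on $Y'$ of class $m$ (the zero divisor of the section $f$ of $\mathcal{L}_m$); one has $D_{fh}=D_f+D_h$. The hypersurface defined by $f$ is $D_f$. If $Y$ is a geometrically integral variety over an arbitrary field $k$ and $M\subseteq\operatorname{Pic}(Y_{\overline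 k})$ is a finitely generated $\operatorname{Gal}(\overline k/k)$-invariant subgroup, a Cox ring of $Y$ over $k$ of type $M$ is a $k$-algebra $R$ such that $R_{\overline k}:=R\otimes_k\overline k$ is a Cox ring of $Y_{\overline k}$ of type $M$ and the natural $\operatorname{Gal}(\overline k/k)$-action on $R_{\overline k}$ is compatible with the Cox ring structure: for all $g\in\operatorname{Gal}(\overline k/k)$ and $m\in M$, $g$ maps the degree-$m$ part of $R_{\overline k}$ to the degree-$gm$ part, and $D_{g(f)}=g(D_f)$ for every nonzero homogeneous $f$. Ideal of a subvariety. For an ideal sheaf $\mathscr{I}\subseteq\mathcal{O}_{Y'}$, $\psi(\mathscr{I})$ denotes the ideal of $R'$ generated by all homogeneous $f\in R'$ with $\mathcal{O}_{Y'}(-D_f)\subseteq\mathscr{I}$. For a closed subvariety $X'\subseteq Y'$, the ideal of $X'$ in $R'$ is $\psi(\mathscr{I}_{X'})$. Strict complete intersection: a closed subvariety $X'\subseteq Y'$ of codimension $s$ is a strict complete intersection with respect to $R'$ of hypersurfaces $H_1,\dots,H_s$ defined by homogeneous $f_1,\dots,f_s\in R'$ if $X'$ is the complete intersection of $H_1,\dots,H_s$ and the ideal $\psi(\mathscr{I}_{X'})$ of $R'$ is generated by $f_1,\dots,f_s$. In the theorem these notions are used with $k'=\overline k$, $Y'=Y_{\overline k}$, $R'=R_{\overline k}$, $X'=X_{\overline k}$. *)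

(* Defs.v *)
From HB Require Import structures.
From mathcomp Require Import all_boot all_order all_algebra.
From mathcomp Require Import separable.
From mathcomp Require Import boolp classical_sets functions cardinality.
From mathcomp Require Import topology.

Set Implicit Arguments.
Unset Strict Implicit.
Unset Printing Implicit Defensive.

Import GRing.Theory.

Local Open Scope classical_set_scope.
Local Open Scope ring_scope.

Record opens (T : topologicalType) := Opens {
  oset :> set T;
  oopen : open oset }.

Definition openT (T : topologicalType) : opens T := Opens (@openT T).

Definition preim (T T' : topologicalType) (f : T -> T') (fc : continuous f)
    (V : opens T') : opens T :=
  Opens ((continuousP f).1 fc V (oopen V)).

(* The inclusion proof [V `<=` U] carried by [res] is irrelevant: [res_id] and
   [res_comp] hold for all such proofs. *)
Record ringedSpace := RingedSpace {
  rs_space :> topologicalType;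
  sec : opens rs_space -> comPzRingType;
  res : forall U V : opens rs_space, V `<=` U -> {rmorphism sec U -> sec V};
  res_id : forall (U : opens rs_space) (h : U `<=` U) s, res h s = s;
  res_comp : forall (U V W : opens rs_space) (hVU : V `<=` U) (hWV : W `<=` V)
    (hWU : W `<=` U) s, res hWV (res hVU s) = res hWU s;
  sec_sep : forall (U : opens rs_space) (I : Type) (V : I -> opens rs_space)
    (hV : forall i, V i `<=` U), U `<=` \bigcup_i V i ->
    forall s t, (forall i, res (hV i) s = res (hV i) t) -> s = t;
  sec_glue : forall (U : opens rs_space) (I : Type) (V : I -> opens rs_space)
    (hV : forall i, V i `<=` U), U `<=` \bigcup_i V i ->
    forall s : (forall i, sec (V i)),
    (forall i j (W : opens rs_space) (hi : W `<=` V i) (hj : W `<=` V j),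
       res hi (s i) = res hj (s j)) ->
    exists t, forall i, res (hV i) t = s i }.

Record modSheaf (X : ringedSpace) := ModSheaf {
  msec : forall U : opens X, lmodType (sec U);
  mres : forall U V : opens X, V `<=` U -> msec U -> msec V;
  mresD : forall (U V : opens X) (h : V `<=` U) s t,
    mres h (s + t) = mres h s + mres h t;
  mresZ : forall (U V : opens X) (h : V `<=` U) a s,
    mres h (a *: s) = res h a *: mres h s;
  mres_id : forall (U : opens X) (h : U `<=` U) s, mres h s = s;
  mres_comp : forall (U V W : opens X) (hVU : V `<=` U) (hWV : W `<=` V)
    (hWU : W `<=` U) s, mres hWV (mres hVU s) = mres hWU s;
  msec_sep : forall (U : opens X) (I : Type) (V : I -> opens X)
    (hV : forall i, V i `<=` U), U `<=` \bigcup_i V i ->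
    forall s t, (forall i, mres (hV i) s = mres (hV i) t) -> s = t;
  msec_glue : forall (U : opens X) (I : Type) (V : I -> opens X)
    (hV : forall i, V i `<=` U), U `<=` \bigcup_i V i ->
    forall s : (forall i, msec (V i)),
    (forall i j (W : opens X) (hi : W `<=` V i) (hj : W `<=` V j),
       mres hi (s i) = mres hj (s j)) ->
    exists t, forall i, mres (hV i) t = s i }.

Definition prime_ideal (A : comPzRingType) (P : set A) : Prop :=
  [/\ P 0, ~ P 1, (forall a b, P a -> P b -> P (a + b)),
      (forall a b, P b -> P (a * b)) &
      (forall a b, P (a * b) -> P a \/ P b)].

Definition is_localization (A B : comPzRingType) (h : A -> B) (f : A) : Prop :=
  [/\ (exists c, h f * c = 1),
      (forall b, exists (a : A) n, b * h f ^+ n = h a) &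
      (forall a, h a = 0 -> exists n, f ^+ n * a = 0)].

(* [(U, O|U)] is isomorphic to [Spec A] with [A = O(U)]: [phi] is a homeomorphism
   from [U] to the set of primes of [A] with its Zariski topology, and on the
   basis of distinguished opens [D(f)] the structure sheaf is [A_f]. *)
Definition affine_open (X : ringedSpace) (U : opens X) : Prop :=
  exists phi : X -> set (sec U),
  [/\ (forall x, oset U x -> prime_ideal (phi x)),
      (forall x y, oset U x -> oset U y -> phi x = phi y -> x = y),
      (forall P, prime_ideal P -> exists2 x, oset U x & phi x = P),
      (forall V : set X, V `<=` U ->
         (open V <-> forall x, V x -> exists2 f, ~ phi x f &
            (forall y, oset U y -> ~ phi y f -> V y))) &
      (forall (f : sec U) (V : opens X) (hV : V `<=` U),
         (V : set X) = [set x | oset U x /\ ~ phi x f] ->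
         is_localization (res hV) f)].

Record scheme := Scheme {
  sch_space :> ringedSpace;
  sch_affine : forall x : sch_space, exists2 U, oset U x & affine_open U }.

(* The germ at [x] of the section [s] is invertible. *)
Definition unit_at (X : ringedSpace) (U : opens X) (s : sec U) (x : X) : Prop :=
  exists (V : opens X) (h : V `<=` U), oset V x /\ exists t, res h s * t = 1.

Record morphism (X Y : ringedSpace) := Morphism {
  mor_fun :> X -> Y;
  mor_cont : continuous mor_fun;
  comor : forall V : opens Y, {rmorphism sec V -> sec (preim mor_cont V)};
  comor_res : forall (V W : opens Y) (h : W `<=` V)
    (h' : preim mor_cont W `<=` preim mor_cont V) s,
    comor W (res h s) = res h' (comor V s);
  comor_local : forall (V : opens Y) (s : sec V) x, oset V (mor_fun x) ->
    unit_at (comor V s) x -> unit_at s (mor_fun x) }.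

Arguments mor_cont {X Y} m : rename.

Definition preimm (X Y : ringedSpace) (f : morphism X Y) (V : opens Y) :
  opens X := preim (mor_cont f) V.

(* Equality of morphisms. The two preimages of [V] are equal only
   propositionally, so the sections are compared after restriction. *)
Definition eq_mor (X Y : ringedSpace) (f g : morphism X Y) : Prop :=
  f =1 g /\
  forall (V : opens Y) (W : opens X) (hf : W `<=` preimm f V)
    (hg : W `<=` preimm g V) s, res hf (comor f V s) = res hg (comor g V s).

Section IdComp.
Variables (X Y Z : ringedSpace).

Lemma id_cont : continuous (@id X).
Proof. by move=> x. Qed.

Lemma id_unit (V : opens X) (s : sec V) x (h : preim id_cont V `<=` V) :
  unit_at (res h s) x -> unit_at s x.
Proof.
move=> [W [hW [Wx [t ht]]]]; exists W, (subset_trans hW h); split=> //.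
by exists t; rewrite -ht; congr (_ * _); rewrite (res_comp _ _ (subset_trans hW h)).
Qed.

Definition id_mor : morphism X X.
Proof.
refine (@Morphism X X id id_cont
  (fun V => res (@subset_refl _ V : preim id_cont V `<=` V)) _ _).
- move=> V W h h' s.
  have hW : preim id_cont W `<=` V by [].
  by rewrite (res_comp _ _ hW) (res_comp _ _ hW).
- by move=> V s x _; apply: id_unit.
Defined.

Variables (g : morphism Y Z) (f : morphism X Y).

Lemma comp_cont : continuous (g \o f).
Proof. by move=> x; apply: continuous_comp; apply: mor_cont. Qed.

Definition comp_comor (V : opens Z) :
    {rmorphism sec V -> sec (preim comp_cont V)} :=
  (res (@subset_refl _ (preimm f (preimm g V)) :
      preim comp_cont V `<=` preimm f (preimm g V))
    \o (comor f (preimm g V) \o comor g V))%FUN.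

Definition comp_mor : morphism X Z.
Proof.
refine (@Morphism X Z (g \o f) comp_cont comp_comor _ _).
- move=> V W h h' s /=.
  have h1 : preimm g W `<=` preimm g V by move=> y; apply: h.
  have h2 : preimm f (preimm g W) `<=` preimm f (preimm g V).
    by move=> y; apply: h.
  have hW : preim comp_cont W `<=` preimm f (preimm g V) by [].
  by rewrite (comor_res h h1) (comor_res h1 h2) (res_comp _ _ hW) (res_comp _ _ hW).
- move=> V s x Vx [W [hW [Wx [t ht]]]].
  apply: (@comor_local _ _ g V s (f x)) => //.
  apply: (@comor_local _ _ f (preimm g V)) => //.
  have hW' : W `<=` preimm f (preimm g V) by [].
  exists W, hW'; split=> //; exists t; rewrite -ht /=; congr (_ * _).
  by rewrite (res_comp _ _ hW').
Defined.

End IdComp.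

(* A morphism [X -> Spec k] is given by the ring morphism [k -> O(X)]. *)
Record schemeOver (k : comPzRingType) := SchemeOver {
  so_scheme :> scheme;
  scal : {rmorphism k -> sec (openT so_scheme)} }.

(* [f] fits in a commutative square over [Spec phi]. *)
Definition over (k k' : comPzRingType) (phi : k -> k')
    (X : schemeOver k') (Y : schemeOver k) (f : morphism X Y) : Prop :=
  forall (h : preimm f (openT Y) `<=` openT X) c,
    comor f (openT Y) (scal Y c) = res h (scal X (phi c)).

(* [X], with [p : X -> Y], is the fibre product of [Y] and [Spec k']
   over [Spec k]. *)
Definition is_base_change (k k' : comPzRingType) (phi : k -> k')
    (Y : schemeOver k) (X : schemeOver k') (p : morphism X Y) : Prop :=
  over phi p /\
  forall (T : schemeOver k') (h : morphism T Y), over phi h ->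
  exists u : morphism T X,
    [/\ over id u, eq_mor (comp_mor p u) h &
        forall v : morphism T X, over id v -> eq_mor (comp_mor p v) h ->
          eq_mor v u].

Definition is_product (k : comPzRingType) (X Y P : schemeOver k)
    (p : morphism P X) (q : morphism P Y) : Prop :=
  [/\ over id p, over id q &
  forall (T : schemeOver k) (a : morphism T X) (b : morphism T Y),
    over id a -> over id b ->
  exists u : morphism T P,
    [/\ over id u, eq_mor (comp_mor p u) a, eq_mor (comp_mor q u) b &
        forall v : morphism T P, over id v -> eq_mor (comp_mor p v) a ->
          eq_mor (comp_mor q v) b -> eq_mor v u]].

Definition closed_immersion (X Y : ringedSpace) (f : morphism X Y) : Prop :=
  [/\ injective f, (forall C : set X, closed C -> closed (f @` C)) &
      forall (V : opens Y) (s : sec (preimm f V)) y, oset V y ->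
      exists (W : opens Y) (t : sec W) (h : preimm f W `<=` preimm f V),
        [/\ oset W y, W `<=` V & comor f W t = res h s]].

Definition separated (k : comPzRingType) (X : schemeOver k) : Prop :=
  exists (P : schemeOver k) (p q : morphism P X) (d : morphism X P),
    [/\ is_product p q, eq_mor (comp_mor p d) (@id_mor X),
        eq_mor (comp_mor q d) (@id_mor X) & closed_immersion d].

Inductive subring_gen (A : pzRingType) (S : set A) : A -> Prop :=
  | SubringGenIn a : S a -> subring_gen S a
  | SubringGen1 : subring_gen S 1
  | SubringGenB a b : subring_gen S a -> subring_gen S b -> subring_gen S (a - b)
  | SubringGenM a b : subring_gen S a -> subring_gen S b -> subring_gen S (a * b).

Definition finite_type (k : comPzRingType) (X : schemeOver k) : Prop :=
  exists (n : nat) (U : 'I_n -> opens X),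
    (forall x, exists i, oset (U i) x) /\
    forall i, affine_open (U i) /\
      exists (r : nat) (a : 'I_r -> sec (U i)),
        forall s, subring_gen
          [set t | (exists (h : U i `<=` openT X) c, t = res h (scal X c))
                   \/ exists j, t = a j] s.

Definition variety (k : fieldType) (X : schemeOver k) : Prop :=
  separated X /\ finite_type X.

Definition integral_scheme (X : scheme) : Prop :=
  (exists x : X, True) /\
  forall U : opens X, (exists x, oset U x) ->
    (1 : sec U) <> 0 /\ forall s t : sec U, s * t = 0 -> s = 0 \/ t = 0.

Definition geometrically_integral (k : fieldType) (X : schemeOver k) : Prop :=
  forall (K : fieldType) (phi : {rmorphism k -> K}) (XK : schemeOver K)
    (p : morphism XK X), is_base_change phi p -> integral_scheme XK.

Definition separable_closure (k K : fieldType) (i : {rmorphism k -> K}) : Prop :=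
  (forall x : K, exists p : {poly k}, separable_poly p /\ root (map_poly i p) x)
  /\ (forall q : {poly K}, separable_poly q -> (1 < size q)%N ->
        exists x, root q x).

Record galois (k K : fieldType) (i : {rmorphism k -> K}) := Galois {
  gal_fun :> {rmorphism K -> K};
  gal_inv : {rmorphism K -> K};
  gal_fix : forall a, gal_fun (i a) = i a;
  gal_funK : cancel gal_fun gal_inv;
  gal_invK : cancel gal_inv gal_fun }.

Lemma gal_inv_fix (k K : fieldType) (i : {rmorphism k -> K}) (g : galois i) a :
  gal_inv g (i a) = i a.
Proof. by rewrite -{1}(gal_fix g a) gal_funK. Qed.

Definition galV (k K : fieldType) (i : {rmorphism k -> K}) (g : galois i) :
    galois i :=
  Galois (gal_inv_fix g) (gal_invK g) (gal_funK g).

Record baseChange (k K : fieldType) (i : {rmorphism k -> K})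
    (Y : schemeOver k) := BaseChange {
  bc_scheme :> schemeOver K;
  bc_proj : morphism bc_scheme Y;
  bc_spec : is_base_change i bc_proj }.

Section GaloisMorphism.
Variables (k K : fieldType) (i : {rmorphism k -> K}) (Y : schemeOver k).
Variables (B : baseChange i Y) (g : galois i).

Definition twist : schemeOver K :=
  @SchemeOver K B (scal B \o gal_inv g)%FUN.

Lemma over_twist :
  @over k K i twist Y (bc_proj B : morphism twist Y).
Proof. by move=> h c; rewrite ((bc_spec B).1 h) /= gal_inv_fix. Qed.

(* The left action of the Galois group on [Y x_k K]: [g] acts as the identity
   on [Y] and as [Spec g^-1] on [Spec K]. *)
Definition galMor : morphism B B :=
  projT1 (cid ((bc_spec B).2 twist (bc_proj B) over_twist)).

Lemma galMor_over : over (gal_inv g) galMor.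
Proof. by rewrite /galMor; case: cid => u [] /= + _ _; apply. Qed.

Lemma galMor_proj : eq_mor (comp_mor (bc_proj B) galMor) (bc_proj B).
Proof. by rewrite /galMor; case: cid => u []. Qed.

Lemma galMor_unique (u : morphism B B) : over (gal_inv g) u ->
  eq_mor (comp_mor (bc_proj B) u) (bc_proj B) -> eq_mor u galMor.
Proof. by rewrite /galMor; case: cid => w [] /= _ _ + hu; apply. Qed.

End GaloisMorphism.

Section Modules.
Variable X : ringedSpace.
Implicit Types F G H : modSheaf X.

Definition is_gen F (U : opens X) (e : msec F U) : Prop :=
  forall (V : opens X) (h : V `<=` U) (s : msec F V),
    exists! a, s = a *: mres h e.

Definition invertible F : Prop :=
  forall x, exists (U : opens X) (e : msec F U), oset U x /\ is_gen e.

Definition sheaf_iso F G : Prop :=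
  exists phi : forall U, {linear msec F U -> msec G U},
    (forall U, bijective (phi U)) /\
    forall (U V : opens X) (h : V `<=` U) s,
      phi V (mres h s) = mres h (phi U s).

Record pairing F G H := Pairing {
  pair_fun :> forall U : opens X, msec F U -> msec G U -> msec H U;
  pairDl : forall U (s s' : msec F U) (t : msec G U),
    pair_fun (s + s') t = pair_fun s t + pair_fun s' t;
  pairDr : forall U (s : msec F U) (t t' : msec G U),
    pair_fun s (t + t') = pair_fun s t + pair_fun s t';
  pairZl : forall U a (s : msec F U) (t : msec G U), pair_fun (a *: s) t = a *: pair_fun s t;
  pairZr : forall U a (s : msec F U) (t : msec G U), pair_fun s (a *: t) = a *: pair_fun s t;
  pair_res : forall (U V : opens X) (h : V `<=` U) s t,
    mres h (pair_fun s t) = pair_fun (mres h s) (mres h t) }.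

(* For invertible [F], [G], [H]: the induced map from the tensor product of [F]
   and [G] to [H] is an isomorphism. Where [e] and [e'] generate [F] and [G],
   that tensor product is free on [e (x) e'], so this means that the image
   of [e (x) e'] generates [H]. *)
Definition perfect F G H (mu : pairing F G H) : Prop :=
  forall (U : opens X) (e : msec F U) (e' : msec G U),
    is_gen e -> is_gen e' -> is_gen (mu U e e').

Definition tensor_iso F G H : Prop := exists mu : pairing F G H, perfect mu.

(* Isomorphism classes of invertible sheaves. They are plain predicates since
   [modSheaf X] lives in too large a universe for [set (modSheaf X)]. *)
Definition Pic : Type :=
  {c : modSheaf X -> Prop |
    exists L, invertible L /\ c = (fun L' => sheaf_iso L L')}.

Definition pic_mem (c : Pic) (L : modSheaf X) : Prop := sval c L.

Definition pic_of L (hL : invertible L) : Pic :=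
  exist _ (fun L' => sheaf_iso L L') (ex_intro _ L (conj hL erefl)).

Definition pic_add (a b c : Pic) : Prop :=
  exists A B C,
    [/\ pic_mem a A, pic_mem b B, pic_mem c C & tensor_iso A B C].

End Modules.

Definition restrict_scalars (A B : pzRingType) (h : {rmorphism A -> B})
    (V : lmodType B) : Type := V.

Section RestrictScalars.
Variables (A B : pzRingType) (h : {rmorphism A -> B}) (V : lmodType B).
Local Notation W := (restrict_scalars h V).

HB.instance Definition _ := GRing.Zmodule.on W.

Definition rs_scale (a : A) (v : W) : W := h a *: (v : V).

Lemma rs_scaleA a b v : rs_scale a (rs_scale b v) = rs_scale (a * b) v.
Proof. by rewrite /rs_scale rmorphM scalerA. Qed.
Lemma rs_scale1 : left_id 1 rs_scale.
Proof. by move=> v; rewrite /rs_scale rmorph1 scale1r. Qed.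
Lemma rs_scaleDr : right_distributive rs_scale +%R.
Proof. by move=> a u v; rewrite /rs_scale scalerDr. Qed.
Lemma rs_scaleDl v : {morph rs_scale^~ v : a b / a + b}.
Proof. by move=> a b; rewrite /rs_scale rmorphD scalerDl. Qed.

HB.instance Definition _ := GRing.Zmodule_isLmodule.Build A W
  rs_scaleA rs_scale1 rs_scaleDr rs_scaleDl.
End RestrictScalars.

Section PushForward.
Variables (X Y : ringedSpace) (f : morphism X Y).

Definition preimm_sub (U V : opens Y) (h : V `<=` U) :
  preimm f V `<=` preimm f U := fun x => h (f x).

Definition push (F : modSheaf X) : modSheaf Y.
Proof.
refine (@ModSheaf Y
  (fun U => restrict_scalars (comor f U) (msec F (preimm f U)))
  (fun U V h => @mres X F _ _ (preimm_sub h)) _ _ _ _ _ _).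
- by move=> U V h s t; apply: mresD.
- move=> U V h a s; rewrite [LHS](mresZ (preimm_sub h)).
  by rewrite -(comor_res h).
- by move=> U h s; apply: mres_id.
- by move=> U V W hVU hWV hWU s; apply: mres_comp.
- move=> U I V hV cov s t; apply: msec_sep.
  by move=> x /cov[j _ Vj]; exists j.
- move=> U I V hV cov s hs.
  apply: (@msec_glue X F (preimm f U) I (fun j => preimm f (V j))).
    by move=> x /cov[j _ Vj]; exists j.
  move=> a b W ha hb.
  pose Wab : opens Y := Opens (openI (oopen (V a)) (oopen (V b))).
  have hWW : W `<=` preimm f Wab by move=> x Wx; split; [apply: ha | apply: hb].
  have h1 : Wab `<=` V a by apply: subIsetl.
  have h2 : Wab `<=` V b by apply: subIsetr.
  have := congr1 (fun z => @mres X F _ _ hWW z) (hs a b Wab h1 h2).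
  by rewrite (mres_comp _ _ ha) (mres_comp _ _ hb).
Defined.

Variables (f' : morphism Y X).
Hypotheses (ff' : eq_mor (comp_mor f f') (@id_mor Y)).
Hypotheses (f'f : eq_mor (comp_mor f' f) (@id_mor X)).

Lemma res_inj (U V : opens Y) (h : V `<=` U) : U `<=` V -> injective (res h).
Proof.
move=> h' s t /(congr1 (res h')).
by rewrite !(res_comp _ _ (@subset_refl _ U)) !res_id.
Qed.

Lemma comor_bij (W : opens Y) (a : sec (preimm f W)) :
  exists! b, a = comor f W b.
Proof.
have sub1 : W `<=` preimm f' (preimm f W).
  by move=> y Wy /=; rewrite [f (f' y)](ff'.1 y).
have sub2 : preimm f W `<=` preimm (comp_mor f' f) (preimm f W).
  by move=> x Wx /=; rewrite /preimage/= [f' (f x)](f'f.1 x).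
have sub3 : W `<=` preimm (comp_mor f f') W.
  by move=> y Wy /=; rewrite /preimage/= [f (f' y)](ff'.1 y).
have sub2' : preimm f W `<=` preimm f (preimm f' (preimm f W)) by [].
exists (res sub1 (comor f' _ a)); split.
- rewrite (comor_res sub1 sub2').
  have /= := f'f.2 (preimm f W) (preimm f W) sub2 (@subset_refl _ _) a.
  by rewrite (res_comp _ _ sub2') (res_comp _ _ (@subset_refl _ (preimm f W)))
    res_id => ->.
- move=> b ab; have /= := ff'.2 W W sub3 (@subset_refl _ _) b.
  rewrite (res_comp _ _ sub1) (res_comp _ _ (@subset_refl _ W)) res_id => E.
  by rewrite -[RHS]E ab.
Qed.

Lemma push_invertible (F : modSheaf X) : invertible F -> invertible (push F).
Proof.
move=> invF y; have [U [e [Ue gene]]] := invF (f' y).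
have sub : preimm f (preimm f' U) `<=` U.
  by move=> x /=; rewrite /preimage/= [f' (f x)](f'f.1 x).
exists (preimm f' U), (mres sub e); split=> // V h s.
have hVU : preimm f V `<=` U by apply: subset_trans (preimm_sub h) sub.
have [a [sa ua]] := gene _ hVU s.
have [b [ab ub]] := comor_bij a.
have E : mres h (mres sub e : msec (push F) (preimm f' U)) = mres hVU e.
  exact: (mres_comp sub (preimm_sub h)).
exists b; split; first by rewrite E sa ab.
move=> b'; rewrite E => sb'; apply: ub; apply: ua; exact: sb'.
Qed.

End PushForward.

Section EqMor.

Lemma res_res (X : ringedSpace) (U V W : opens X) (hVU : V `<=` U)
    (hWV : W `<=` V) s :
  res hWV (res hVU s) = res (subset_trans hWV hVU) s.
Proof. exact: res_comp. Qed.

Lemma res_irr (X : ringedSpace) (U V : opens X) (h h' : V `<=` U) s :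
  res h s = res h' s.
Proof. by rewrite (Prop_irrelevance h h'). Qed.

Lemma eq_mor_refl (X Y : ringedSpace) (f : morphism X Y) : eq_mor f f.
Proof.
split=> // V W hf hg s.
by rewrite -(res_comp (@subset_refl _ (preimm f V)) hf hg) res_id.
Qed.

Lemma eq_mor_sym (X Y : ringedSpace) (f g : morphism X Y) :
  eq_mor f g -> eq_mor g f.
Proof. by move=> [fg fgs]; split=> [x|V W hf hg s]; [rewrite fg | rewrite fgs]. Qed.

Lemma eq_mor_trans (X Y : ringedSpace) (f g h : morphism X Y) :
  eq_mor f g -> eq_mor g h -> eq_mor f h.
Proof.
move=> [fg fgs] [gh ghs]; split=> [x|V W hf hh s]; first by rewrite fg gh.
have hg : W `<=` preimm g V.
  by move=> x /hf; rewrite /preimm/= /preimage/= fg.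
by rewrite (fgs _ _ _ hg) ghs.
Qed.

Lemma eq_mor_compA (X Y Z T : ringedSpace) (f : morphism X Y)
    (g : morphism Y Z) (h : morphism Z T) :
  eq_mor (comp_mor h (comp_mor g f)) (comp_mor (comp_mor h g) f).
Proof.
split=> // V W h1 h2 s /=.
have h5 : preimm f (preimm (comp_mor h g) V) `<=` preimm f (preimm g (preimm h V)).
  by [].
by rewrite (comor_res _ h5) !res_res; apply: res_irr.
Qed.

Lemma eq_mor_compl (X Y Z : ringedSpace) (f : morphism X Y)
    (g g' : morphism Y Z) :
  eq_mor g g' -> eq_mor (comp_mor g f) (comp_mor g' f).
Proof.
move=> [gg' gs]; split=> [x|V W h1 h2 s] /=; first by rewrite gg'.
have sub : preimm g V `<=` preimm g' V.
  by move=> y; rewrite /preimm/= /preimage/= gg'.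
have := gs V (preimm g V) (@subset_refl _ _) sub s; rewrite res_id => ->.
have sub' : preimm f (preimm g V) `<=` preimm f (preimm g' V).
  by move=> x; apply: sub.
by rewrite (comor_res _ sub') !res_res; apply: res_irr.
Qed.

Lemma eq_mor_id (X Y : ringedSpace) (f : morphism X Y) :
  eq_mor (comp_mor f (@id_mor X)) f.
Proof. by split=> // V W h1 h2 s /=; rewrite !res_res; apply: res_irr. Qed.

Lemma over_comp (k1 k2 k3 : comPzRingType) (phi : k1 -> k2) (psi : k2 -> k3)
    (Z : schemeOver k1) (Y : schemeOver k2) (X : schemeOver k3)
    (g : morphism Y Z) (f : morphism X Y) :
  over phi g -> over psi f -> over (psi \o phi)%FUN (comp_mor g f).
Proof.
move=> hg hf h c /=.
have h1 : preimm g (openT Z) `<=` openT Y by [].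
have h2 : preimm f (preimm g (openT Z)) `<=` preimm f (openT Y) by [].
have h3 : preimm f (openT Y) `<=` openT X by [].
rewrite (hg h1) (comor_res h1 h2) (hf h3).
by rewrite !res_res; apply: res_irr.
Qed.

Lemma over_id (k : comPzRingType) (X : schemeOver k) :
  @over k k id X X (@id_mor X).
Proof.
by move=> h c /=; apply: res_irr.
Qed.

End EqMor.

Section GaloisAction.
Variables (k K : fieldType) (i : {rmorphism k -> K}) (Y : schemeOver k).
Variable B : baseChange i Y.

Lemma galMorK (g g' : galois i) : cancel (gal_inv g) (gal_inv g') ->
  eq_mor (comp_mor (galMor B g) (galMor B g')) (@id_mor B).
Proof.
move=> gK.
have [w [_ _ wu]] := (bc_spec B).2 B (bc_proj B) (bc_spec B).1.
have e1 : eq_mor (comp_mor (galMor B g) (galMor B g')) w.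
  apply: wu.
    move=> h c; have o1 : over (gal_inv g) (galMor B g) by exact: galMor_over.
    have o2 : over (gal_inv g') (galMor B g') by exact: galMor_over.
    rewrite (over_comp o1 o2 h) /=.
    by rewrite gK.
  apply: eq_mor_trans (eq_mor_compA _ _ _) _.
  exact: eq_mor_trans (eq_mor_compl _ (galMor_proj B g)) (galMor_proj B g').
have e2 : eq_mor (@id_mor B) w.
  by apply: wu; [exact: over_id | exact: eq_mor_id].
exact: eq_mor_trans e1 (eq_mor_sym e2).
Qed.

Lemma push_gal_invertible g (L : modSheaf B) :
  invertible L -> invertible (push (galMor B g) L).
Proof.
apply: (@push_invertible _ _ _ (galMor B (galV g))); apply: galMorK => c.
  exact: gal_invK.
exact: gal_funK.
Qed.

(* [g] sends the class of [L] to the class of its direct image under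
   the automorphism [galMor B g]. *)
Definition pic_act (g : galois i) (c : Pic B) : Pic B :=
  let r := cid (projT2 c) in
  pic_of (push_gal_invertible g (projT2 r).1).

End GaloisAction.

Section Ideals.
Variable X : ringedSpace.

Definition ideals : Type := forall U : opens X, set (sec U).

Definition ideal_sheaf (I : ideals) : Prop :=
  [/\ (forall U, I U 0),
      (forall U a b, I U a -> I U b -> I U (a + b)),
      (forall U a b, I U b -> I U (a * b)),
      (forall (U V : opens X) (h : V `<=` U) a, I U a -> I V (res h a)) &
      (forall (U : opens X) a,
         (forall x, oset U x -> exists (V : opens X) (h : V `<=` U),
            oset V x /\ I V (res h a)) ->
         I U a)].

(* For an affine open [U] and [f] in [O(U)], [I(D(f))] is the localization
   of [I(U)] at [f]. *)
Definition quasi_coherent (I : ideals) : Prop :=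
  forall (U : opens X), affine_open U ->
  forall (f : sec U) (V : opens X) (h : V `<=` U),
    (V : set X) = [set x | oset U x /\ unit_at f x] ->
  forall a, I V (res h a) -> exists n, I U (f ^+ n * a).

Definition closed_subscheme (I : ideals) : Prop :=
  ideal_sheaf I /\ quasi_coherent I.

Definition zero_set (I : ideals) : set X :=
  [set x | forall (U : opens X) (a : sec U), oset U x -> I U a -> ~ unit_at a x].

Definition eff_cartier (I : ideals) : Prop :=
  ideal_sheaf I /\
  forall x, exists (U : opens X) (f : sec U), oset U x /\
    forall (V : opens X) (h : V `<=` U),
      (forall a, a * res h f = 0 -> a = 0) /\
      (forall a, I V a <-> exists b, a = b * res h f).

Definition sum_ideals (n : nat) (H : 'I_n -> ideals) : ideals := fun U =>
  [set a | forall x, oset U x -> exists (V : opens X) (h : V `<=` U),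
     oset V x /\ exists b : 'I_n -> sec V,
       (forall j, H j V (b j)) /\ res h a = \sum_(j < n) b j].

(* The ideal sheaf [O(-D_s)] of the zero divisor [D_s] of a section [s] of an
   invertible sheaf: where [e] is a generator and [s = b *: e], it is
   generated by [b]. *)
Definition zero_div (L : modSheaf X) (s : msec L (openT X)) : ideals := fun U =>
  [set a | forall x, oset U x ->
     exists (V : opens X) (h : V `<=` U) (hT : V `<=` openT X) (e : msec L V) b,
     [/\ oset V x, is_gen e, mres hT s = b *: e & exists d, res h a = d * b]].

Definition structure_sheaf : modSheaf X.
Proof.
refine (@ModSheaf X (fun U => (sec U)^o) (fun U V h => res h) _ _ _ _ _ _).
- by move=> U V h s t; apply: rmorphD.
- by move=> U V h a s; apply: rmorphM.
- exact: res_id.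
- exact: res_comp.
- exact: sec_sep.
- exact: sec_glue.
Defined.

Section IdealModule.
Variables (I : ideals) (hI : ideal_sheaf I).
Arguments I U : clear implicits.

Section Sections.
Variable U : opens X.

(* The proof [hI] is a parameter so that the instances below can be inferred. *)
Definition ideal_pred of ideal_sheaf I : pred (sec U)^o := fun a => a \in I U.

Lemma ideal_pred_closed : submod_closed (ideal_pred hI).
Proof.
have [I0 ID IM _ _] := hI; split; first by apply: mem_set.
by move=> a u v /set_mem Iu /set_mem Iv; apply: mem_set; apply: ID => //; apply: IM.
Qed.

HB.instance Definition _ :=
  GRing.isSubmodClosed.Build (sec U) (sec U)^o (ideal_pred hI) ideal_pred_closed.

Record ideal_sec := IdealSec {
  ideal_val : (sec U)^o; ideal_valP : ideal_val \in ideal_pred hI }.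

HB.instance Definition _ := [isSub for ideal_val].
HB.instance Definition _ := [Choice of ideal_sec by <:].
HB.instance Definition _ := [SubChoice_isSubLmodule of ideal_sec by <:].

Lemma ideal_secP (a : ideal_sec) : I U (ideal_val a).
Proof. by case: a => a /= /set_mem. Qed.

End Sections.

Lemma ideal_res_subproof (U V : opens X) (h : V `<=` U) (a : ideal_sec U) :
  res h (ideal_val a) \in @ideal_pred V hI.
Proof. by apply: mem_set; have [_ _ _ + _] := hI; apply; apply: ideal_secP. Qed.

Definition ideal_res (U V : opens X) (h : V `<=` U) (a : ideal_sec U) :
  ideal_sec V := IdealSec (ideal_res_subproof h a).

Definition ideal_module : modSheaf X.
Proof.
refine (@ModSheaf X (fun U => ideal_sec U : lmodType _) ideal_res _ _ _ _ _ _).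
- by move=> U V h s t; apply: val_inj; apply: rmorphD.
- by move=> U V h a s; apply: val_inj; apply: rmorphM.
- by move=> U h s; apply: val_inj; apply: res_id.
- by move=> U V W hVU hWV hWU s; apply: val_inj; apply: res_comp.
- move=> U J V hV cov s t hst; apply: val_inj; apply: (sec_sep cov) => j.
  exact: (congr1 (@ideal_val (V j)) (hst j)).
- move=> U J V hV cov s hs.
  have [|t ht] := @sec_glue X U J V hV cov (fun j => ideal_val (s j)).
    by move=> a b W ha hb; exact: (congr1 (@ideal_val W) (hs a b W ha hb)).
  have It : t \in @ideal_pred U hI.
    apply: mem_set; have [_ _ _ _ loc] := hI; apply: loc => x /cov[j _ Vjx].
    by exists (V j), (hV j); split=> //; rewrite ht; apply: ideal_secP.
  by exists (IdealSec It) => j; apply: val_inj; apply: ht.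
Defined.

End IdealModule.

(* [c] is the class [[H]] of [O(H)], the inverse of the class of the ideal
   sheaf [O(-H)]. *)
Definition div_class (H : ideals) (c : Pic X) : Prop :=
  exists (hH : ideal_sheaf H) (L : modSheaf X),
    pic_mem c L /\ tensor_iso L (ideal_module hH) structure_sheaf.

End Ideals.

Section IdealTransport.
Variables (X Y : ringedSpace) (f : morphism X Y).

(* The ideal sheaf generated by the pullback of [J]: it defines the base change
   along [f] of the closed subscheme defined by [J]. *)
Definition inv_ideal (J : ideals Y) : ideals X := fun U =>
  [set a | forall x, oset U x ->
     exists (W : opens X) (h : W `<=` U) (V : opens Y) (hV : W `<=` preimm f V)
       (n : nat) (b : 'I_n -> sec W) (c : 'I_n -> sec V),
     [/\ oset W x, (forall j, J V (c j)) &
         res h a = \sum_(j < n) b j * res hV (comor f V (c j))]].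

(* For an automorphism [f], the ideal sheaf of the image under [f] of
   the closed subscheme defined by [I]. *)
Definition image_ideal (I : ideals X) : ideals Y := fun U =>
  [set a | I (preimm f U) (comor f U a)].

End IdealTransport.

Section Dimension.
Variable T : topologicalType.

Definition irreducible (Z : set T) : Prop :=
  Z !=set0 /\
  forall A B, closed A -> closed B -> Z `<=` A `|` B -> Z `<=` A \/ Z `<=` B.

Definition irr_chain (Z : set T) (d : nat) : Prop :=
  exists F : nat -> set T,
    (forall j, (j <= d)%N -> [/\ closed (F j), irreducible (F j) & F j `<=` Z])
    /\ (forall j, (j < d)%N -> F j `<` F j.+1).

(* Krull dimension of a closed subset; the empty set has none. *)
Definition has_dim (Z : set T) (d : nat) : Prop :=
  irr_chain Z d /\ ~ irr_chain Z d.+1.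

End Dimension.

Definition complete_intersection (X : scheme) (I : ideals X) (s : nat)
    (H : 'I_s -> ideals X) : Prop :=
  [/\ (forall j, eff_cartier (H j)),
      (exists d, has_dim (zero_set I) d /\ has_dim [set: X] (d + s)%N) &
      I = sum_ideals H].

Section CoxRing.
Variables (K : fieldType) (X : schemeOver K) (M : zmodType) (cl : M -> Pic X).

(* [cl] identifies [M] with a subgroup of [Pic X]. *)
Definition pic_subgroup : Prop :=
  [/\ injective cl, pic_mem (cl 0) (structure_sheaf X) &
      forall m m', pic_add (cl m) (cl m') (cl (m + m'))].

(* The equations [m + m' = n] avoid transports between the sheaves of equal
   degrees. *)
Record coxSheaf := CoxSheaf {
  cs_sheaf :> M -> modSheaf X;
  cs_class : forall m, pic_mem (cl m) (cs_sheaf m);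
  cs_mul : forall m m' n, m + m' = n ->
    pairing (cs_sheaf m) (cs_sheaf m') (cs_sheaf n);
  cs_perfect : forall m m' n (e : m + m' = n), perfect (cs_mul e);
  cs_mulC : forall m m' n (e : m + m' = n) (e' : m' + m = n) U s t,
    cs_mul e U s t = cs_mul e' U t s;
  cs_mulA : forall m1 m2 m3 m12 m23 n (e12 : m1 + m2 = m12)
    (e23 : m2 + m3 = m23) (e : m12 + m3 = n) (e' : m1 + m23 = n) U s t u,
    cs_mul e U (cs_mul e12 U s t) u = cs_mul e' U s (cs_mul e23 U t u);
  cs_one : msec (cs_sheaf 0) (openT X);
  cs_one_gen : is_gen cs_one;
  cs_mul1 : forall m (e : 0 + m = m) (U : opens X) (h : U `<=` openT X) s,
    cs_mul e U (mres h cs_one) s = s }.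

(* [A] is the graded algebra of global sections of a Cox sheaf, the degree [m]
   part being the image of [cx_emb m]. *)
Record coxRing (A : comAlgType K) := CoxRing {
  cx_sheaf :> coxSheaf;
  cx_emb : forall m, msec (cx_sheaf m) (openT X) -> A;
  cx_embD : forall m (s t : msec (cx_sheaf m) (openT X)),
    cx_emb (s + t) = cx_emb s + cx_emb t;
  cx_embZ : forall m c (s : msec (cx_sheaf m) (openT X)),
    cx_emb (scal X c *: s) = c *: cx_emb s;
  cx_emb1 : cx_emb (cs_one cx_sheaf) = 1;
  cx_embM : forall m m' n (e : m + m' = n) s t,
    cx_emb (cs_mul cx_sheaf e (openT X) s t) = cx_emb s * cx_emb t;
  cx_direct : forall (r : seq M) (s : forall m, msec (cx_sheaf m) (openT X)),
    uniq r -> \sum_(m <- r) cx_emb (s m) = 0 ->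
    forall m, m \in r -> s m = 0;
  cx_span : forall f : A,
    exists (r : seq M) (s : forall m, msec (cx_sheaf m) (openT X)),
      f = \sum_(m <- r) cx_emb (s m) }.

Arguments cx_emb {A} c {m} s : rename.

Variables (A : comAlgType K) (C : coxRing A).

Definition in_degree (m : M) (f : A) : Prop :=
  exists s : msec (C m) (openT X), f = cx_emb C s.

(* [f] is nonzero homogeneous and [D] is the ideal sheaf of [D_f]. *)
Definition defines (f : A) (D : ideals X) : Prop :=
  f <> 0 /\ exists m (s : msec (C m) (openT X)), f = cx_emb C s /\ D = zero_div s.

Definition ideal_gen (S : set A) : set A :=
  [set x | exists (n : nat) (a b : 'I_n -> A),
     (forall j, S (b j)) /\ x = \sum_(j < n) a j * b j].

Definition cox_ideal (I : ideals X) : set A :=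
  ideal_gen [set f | exists2 D, defines f D & forall U, D U `<=` I U].

Definition strict_complete_intersection (I : ideals X) (s : nat)
    (H : 'I_s -> ideals X) (f : 'I_s -> A) : Prop :=
  [/\ (forall j, defines (f j) (H j)), complete_intersection I H &
      cox_ideal I = ideal_gen (range f)].

End CoxRing.

Definition finitely_generated (M : zmodType) : Prop :=
  exists (n : nat) (e : 'I_n -> M),
    forall m, exists a : 'I_n -> int, m = \sum_(j < n) e j *~ a j.

Section CoxDescent.
Variables (k K : fieldType) (i : {rmorphism k -> K}) (R : comAlgType k).

(* [RK] is the tensor product of [R] and [K] over [k], that is, the pushout of
   [R] and [K] under [k] in the category of commutative rings. *)
Definition is_tensor (RK : comAlgType K) (j : {rmorphism R -> RK}) : Prop :=
  (forall a : k, j a%:A = (i a)%:A) /\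
  forall (S : comPzRingType) (alpha : {rmorphism R -> S})
    (beta : {rmorphism K -> S}), (forall a : k, alpha a%:A = beta (i a)) ->
  exists gamma : {rmorphism RK -> S},
    [/\ (forall r, gamma (j r) = alpha r), (forall c : K, gamma c%:A = beta c) &
        forall gamma' : {rmorphism RK -> S}, (forall r, gamma' (j r) = alpha r) ->
          (forall c : K, gamma' c%:A = beta c) -> gamma' =1 gamma].

Record baseChangeAlg := BaseChangeAlg {
  bca_alg :> comAlgType K;
  bca_inj : {rmorphism R -> bca_alg};
  bca_spec : is_tensor bca_inj }.

Section GaloisAlg.
Variables (RK : baseChangeAlg) (g : galois i).

Lemma galAlg_subproof a : bca_inj RK a%:A = (in_alg RK \o g)%FUN (i a).
Proof. by rewrite (bca_spec RK).1 /= gal_fix. Qed.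

(* [g] acts as the identity on [R] and as [g] on [K]. *)
Definition galAlg : {rmorphism RK -> RK} :=
  projT1 (cid ((bca_spec RK).2 RK (bca_inj RK) (in_alg RK \o g)%FUN
                 galAlg_subproof)).

End GaloisAlg.

Definition galois_compatible (Y : schemeOver k) (B : baseChange i Y)
    (M : zmodType) (cl : M -> Pic B) (RK : baseChangeAlg) (C : coxRing cl RK) :
    Prop :=
  forall g : galois i,
    (forall m m' f, cl m' = pic_act g (cl m) ->
       in_degree C m f -> in_degree C m' (galAlg RK g f)) /\
    (forall f D, defines C f D ->
       defines C (galAlg RK g f) (image_ideal (galMor B g) D)).

End CoxDescent.

Definition has_card (T : Type) (P : T -> Prop) (n : nat) : Prop :=
  exists e : 'I_n -> T, injective e /\ forall t, P t <-> exists j, e j = t.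

(* Indices start at 0: the [l]-th block is [sb l, ..., sb l.+1 - 1]. *)
Definition in_block (sb : nat -> nat) (s l : nat) (j : 'I_s) : Prop :=
  (sb l <= j < sb l.+1)%N.

Definition is_orbit (G T : Type) (act : G -> T -> T) (P : T -> Prop) : Prop :=
  exists t, forall t', P t' <-> exists g, t' = act g t.

(* Main.v *)
(** The ideal [V] of [X] in the Cox ring is Galois stable. Since the Cox ring is
    a [K]-form of a [k]-algebra, Galois descent shows that the degree [m] part of
    [V] is spanned by vectors fixed under the stabilizer of [m]. In a degree [m]
    chosen in each Galois orbit of degrees, the generators [f_j] of that degree
    can therefore be exchanged for stabilizer-fixed ones, modulo the part of [V]
    generated by the [f_l] of other degrees, and the new generators transported
    along the orbit. As the degree 0 part of the Cox ring is [K], "some nonzero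
    section has degree [m' - m]" is a partial order on the degrees of the [f_j],
    and induction along it shows that the new family still generates [V]. Its
    zero divisors have the same sum of ideal sheaves, have the classes of the
    old ones, and are permuted by the Galois group like these classes. *)
From HB Require Import structures.
Require Import Defs.
From mathcomp Require Import all_boot all_order all_algebra.
From mathcomp Require Import separable.
From mathcomp Require Import boolp classical_sets functions cardinality.
From mathcomp Require Import topology.

Set Implicit Arguments.
Unset Strict Implicit.
Unset Printing Implicit Defensive.

Import GRing.Theory.
Local Open Scope classical_set_scope.
Local Open Scope ring_scope.

Local Notation openT := Defs.openT.

(** * Sections on integral schemes *)

Section RingedSpaces.
Variable X : ringedSpace.
Implicit Types U V W : opens X.

(** The Galois group permutes the degrees, so one degree part of the Cox ring is stable only under
    the stabilizer of that degree; this is why fixed vectors are sought in one degree per orbit and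
    then moved to the others. Strictness is what gives Galois stability: the ideal of X depends on X
    alone, whereas the ideal generated by arbitrary equations of X need not be stable. The condition
    on the cardinality of the orbits makes each class occur once in its block, so that an element
    fixing a class also fixes its index, and the transport along the orbit is well defined.
    Different blocks may carry the same classes; hence all generators of one degree are exchanged
    together, and representatives are chosen per orbit of degrees, not per block. The exchange holds
    only modulo terms from generators of other degrees, which are changed as well; without
    antisymmetry of the order on degrees this would be circular. Antisymmetry holds since a nonzero
    product of sections of opposite degrees is a nonzero constant, so that both trivialize their
    sheaves. *)

Definition opensI (U V : opens X) : opens X := Opens (openI (oopen U) (oopen V)).
Definition opensU (U V : opens X) : opens X := Opens (openU (oopen U) (oopen V)).

Lemma subT U : U `<=` openT X.
Proof. by []. Qed.

Lemma sec_local U (s t : sec U) :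
  (forall x, oset U x ->
     exists V (h : V `<=` U), oset V x /\ res h s = res h t) -> s = t.
Proof.
move=> loc.
pose J := {V : opens X | exists h : V `<=` U, res h s = res h t}.
pose F (j : J) := sval j.
have hF (j : J) : F j `<=` U by case: j => V [].
apply: (@sec_sep X U J F hF).
- move=> x /loc[V [h [Vx e]]].
  by exists (exist _ V (ex_intro _ h e)).
- by case=> V [h e]; rewrite (res_irr _ h) e; apply: res_irr.
Qed.

Lemma mres_irr (F : modSheaf X) U V (h h' : V `<=` U) (s : msec F U) :
  mres h s = mres h' s.
Proof. by rewrite (Prop_irrelevance h h'). Qed.

Lemma msec_local (F : modSheaf X) U (s t : msec F U) :
  (forall x, oset U x ->
     exists V (h : V `<=` U), oset V x /\ mres h s = mres h t) -> s = t.
Proof.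
move=> loc.
pose J := {V : opens X | exists h : V `<=` U, mres h s = mres h t}.
pose G (j : J) := sval j.
have hG (j : J) : G j `<=` U by case: j => V [].
apply: (@msec_sep X F U J G hG).
- move=> x /loc[V [h [Vx e]]].
  by exists (exist _ V (ex_intro _ h e)).
- by case=> V [h e]; rewrite (mres_irr _ h) e; apply: mres_irr.
Qed.

Lemma mres_res (F : modSheaf X) U V W (hVU : V `<=` U) (hWV : W `<=` V)
    (s : msec F U) :
  mres hWV (mres hVU s) = mres (subset_trans hWV hVU) s.
Proof. exact: mres_comp. Qed.

Lemma mres0 (F : modSheaf X) U V (h : V `<=` U) : mres h (0 : msec F U) = 0.
Proof. by rewrite -(scale0r (0 : msec F U)) mresZ rmorph0 scale0r. Qed.

Lemma mres_sum (F : modSheaf X) U V (h : V `<=` U) (J : Type) (r : seq J)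
    (P : pred J) (s : J -> msec F U) :
  mres h (\sum_(j <- r | P j) s j) = \sum_(j <- r | P j) mres h (s j).
Proof. by apply: (big_morph _ (mresD h)); apply: mres0. Qed.

(** The cover consists of all local solutions at once; uniqueness makes them agree on overlaps, so
    they glue. The conclusion stays local because [P] itself is not asked to be a local
    condition. *)
Lemma msec_solve (F : modSheaf X) (U : opens X)
    (P : forall V, V `<=` U -> msec F V -> Prop) :
  (forall V W (h : V `<=` U) (h' : W `<=` V) (hW : W `<=` U) s,
     P V h s -> P W hW (mres h' s)) ->
  (forall V (h : V `<=` U) s t, P V h s -> P V h t -> s = t) ->
  (forall x, oset U x -> exists V (h : V `<=` U), oset V x /\ exists s, P V h s) ->
  exists t, forall x, oset U x -> exists V (h : V `<=` U),
    oset V x /\ P V h (mres h t).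
Proof.
move=> Pres Puniq Pex.
pose J := {V : opens X & {h : V `<=` U & {s : msec F V | P V h s}}}.
pose G (j : J) := projT1 j.
have hG (j : J) : G j `<=` U by case: j => V [].
pose s (j : J) : msec F (G j) := projT1 (projT2 (projT2 j)).
have sP (j : J) : P _ (hG j) (s j).
  rewrite /s; move: (hG j); case: j => V [h [t Pt]] /= h'.
  by rewrite (Prop_irrelevance h' h).
have [x /Pex[V [h [Vx [t Pt]]]]||t tP] := @msec_glue X F U J G hG _ s.
- by exists (existT _ V (existT _ h (exist _ t Pt))).
- move=> a b W ha hb.
  by apply: (Puniq W (subset_trans ha (hG a))); apply: Pres; apply: sP.
exists t => x /Pex[V [h [Vx [u Pu]]]]; exists V, h; split=> //.
have := tP (existT _ V (existT _ h (exist _ u Pu))).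
by move: (hG _); rewrite /G/s/= => h' e; rewrite (mres_irr h h') e.
Qed.

Lemma gen_res (F : modSheaf X) U V (h : V `<=` U) (e : msec F U) :
  is_gen e -> is_gen (mres h e).
Proof.
by move=> ge W hW s; rewrite mres_res; apply: ge.
Qed.

Lemma gen_ex (F : modSheaf X) U (e : msec F U) : is_gen e ->
  forall V (h : V `<=` U) (s : msec F V), exists a, s = a *: mres h e.
Proof. by move=> ge V h s; have [a []] := ge V h s; exists a. Qed.

Lemma gen_ex1 (F : modSheaf X) U (e : msec F U) : is_gen e ->
  forall (s : msec F U), exists a, s = a *: e.
Proof.
by move=> ge s; have [a] := gen_ex ge (@subset_refl _ U) s; rewrite mres_id; exists a.
Qed.

Lemma gen_inj (F : modSheaf X) U (e : msec F U) : is_gen e ->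
  forall V (h : V `<=` U) a b, a *: mres h e = b *: mres h e -> a = b.
Proof.
move=> ge V h a b E; have [c [_ cu]] := ge V h (a *: mres h e).
by rewrite -(cu a) // -(cu b).
Qed.

Lemma gen_inj1 (F : modSheaf X) U (e : msec F U) : is_gen e ->
  forall a b, a *: e = b *: e -> a = b.
Proof.
by move=> ge a b E; apply: (@gen_inj F U e ge U (@subset_refl _ U)); rewrite mres_id.
Qed.

Lemma common_nbhs (J : finType) (x : X) (P : J -> opens X -> Prop) :
  (forall j V W, W `<=` V -> P j V -> P j W) ->
  (forall j, exists V, oset V x /\ P j V) ->
  exists V, oset V x /\ forall j, P j V.
Proof.
move=> mono ex.
suff [V [Vx VP]] : exists V, oset V x /\ forall j, j \in enum J -> P j V.
  by exists V; split=> // j; apply: VP; rewrite mem_enum.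
elim: (enum J) => [|j r [V [Vx VP]]]; first by exists (openT X).
have [W [Wx WP]] := ex j; exists (opensI V W); split=> //= l.
rewrite inE => /predU1P[->|lr]; first by apply: mono WP => y [].
by apply: mono (VP l lr) => y [].
Qed.

End RingedSpaces.

Section Integral.
Variable X : scheme.
Hypothesis intX : integral_scheme X.
Implicit Types U V W : opens X.

Lemma integral_neq0 U : U !=set0 -> (1 : sec U) <> 0.
Proof. by move=> [x Ux]; have [] := intX.2 U (ex_intro _ x Ux). Qed.

Lemma integral_mul0 U (a b : sec U) : U !=set0 -> a * b = 0 -> a = 0 \/ b = 0.
Proof. by move=> [x Ux]; have [_] := intX.2 U (ex_intro _ x Ux); apply. Qed.

(** On a union of disjoint opens, the function that is 1 on one and 0 on the other has product 0
    with its complement; in a domain one of the two vanishes, which is impossible on a nonempty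
    open. *)
Lemma integral_meet U V : U !=set0 -> V !=set0 -> U `&` V !=set0.
Proof.
move=> U0 V0; apply: contrapT => /set0P/negP; rewrite negbK => /eqP UV0.
pose F (b : bool) := if b then U else V.
have hF b : F b `<=` opensU U V by case: b => x ?; [left|right].
have cov : opensU U V `<=` \bigcup_b F b.
  by move=> x [Ux|Vx]; [exists true|exists false].
have glue b0 : exists t : sec (opensU U V), forall b : bool,
    res (hF b) t = (b == b0)%:R.
  apply: (@sec_glue X (opensU U V) bool F hF cov (fun b : bool => (b == b0)%:R)).
  move=> a b W; case: (eqVneq a b) => [->|ab] ha hb; first by rewrite !rmorph_nat.
  apply: sec_local => x Wx; suff : set0 x by [].
  by rewrite -UV0; case: a b ha hb ab => [] [] // ha hb _; split; auto.
have [t1 t1P] := glue true; have [t0 t0P] := glue false.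
have : t1 * t0 = 0.
  apply: (sec_sep cov (hV := hF)) => b.
  by rewrite rmorphM rmorph0 t1P t0P; case: b; rewrite ?mulr0 ?mul0r.
have UV : opensU U V !=set0 by case: U0 => x; exists x; left.
move=> /(integral_mul0 UV)[] e.
- by have := t1P true; rewrite e rmorph0 => /esym /integral_neq0.
- by have := t0P false; rewrite e rmorph0 => /esym /integral_neq0.
Qed.

Lemma integral_expr0 U (a : sec U) n : U !=set0 -> a ^+ n = 0 -> a = 0.
Proof.
move=> U0; elim: n => [|n IHn]; first by rewrite expr0 => /integral_neq0.
by rewrite exprS => /(integral_mul0 U0)[].
Qed.

Lemma affine_basis U (aU : affine_open U) x V : oset V x -> oset U x ->
  exists (f : sec U) W (hW : W `<=` U),
    [/\ W `<=` V, oset W x & is_localization (res hW) f] /\ f <> 0.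
Proof.
have [phi [phiP phiI phiS phiO phiL]] := aU => Vx Ux.
have [h1 _] := phiO (opensI V U) (@subIsetr _ _ _).
have [f fx fV] := h1 (oopen _) x (conj Vx Ux).
pose D := [set y | oset U y /\ ~ phi y f].
have DU : D `<=` U by move=> y [].
have oD : open D by apply/(phiO D DU) => y [Uy fy]; exists f.
exists f, (Opens oD), DU; split; first split => //.
- by move=> y [Uy fy]; have [] := fV y Uy fy.
- exact: phiL.
- by move=> f0; apply: fx; rewrite f0; case: (phiP x Ux).
Qed.

(** A function vanishing on [V] vanishes on a distinguished open inside [V], so a power of some
    nonzero [f] kills it in the domain of sections over [U]. *)
Lemma affine_res_inj U V (h : V `<=` U) (a : sec U) : affine_open U ->
  V !=set0 -> res h a = 0 -> a = 0.
Proof.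
move=> aU [x Vx] a0; have Ux := h x Vx.
have [f [W [hW [[WV Wx [_ _ loc0]] f0]]]] := affine_basis aU Vx Ux.
have [|n] := loc0 a.
  by rewrite (res_irr _ (subset_trans WV h)) -res_res a0 rmorph0.
have U0 : U !=set0 by exists x.
by move=> /(integral_mul0 U0)[/(integral_expr0 U0)|].
Qed.

(** Near each point the section is a fraction over an affine open [W]. By irreducibility the domain
    of this fraction meets [V]; the numerator vanishes there, hence on [W] by the affine case. *)
Lemma sec_res_inj U V (h : V `<=` U) (a : sec U) :
  V !=set0 -> res h a = 0 -> a = 0.
Proof.
move=> V0 a0; apply: sec_local => x Ux; have [W Wx aW] := sch_affine x.
have [f [D [hD [[DU Dx [[c fc] locS _]] f0]]]] := affine_basis aW Ux Wx.
exists D, DU; split=> //; rewrite rmorph0.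
have [a' [n]] := locS (res DU a).
have [|y [Dy Vy]] := @integral_meet D V _ V0; first by exists x.
pose N := opensI D V; have ND : N `<=` D by apply: subIsetl.
have NW : N `<=` W by exact: (subset_trans ND hD).
have NV : N `<=` V by apply: subIsetr.
move=> E; suff a'0 : a' = 0.
  move: E; rewrite a'0 rmorph0 => /(congr1 (fun z => z * c ^+ n)).
  by rewrite mul0r -mulrA -exprMn fc expr1n mulr1.
apply: (@affine_res_inj W N NW) => //; first by exists y.
have := congr1 (res ND) E; rewrite rmorphM !res_res (res_irr _ (subset_trans NV h)).
by rewrite -res_res a0 rmorph0 mul0r => /esym <-; apply: res_irr.
Qed.

Lemma msec_res_inj (L : modSheaf X) U V (h : V `<=` U) (s : msec L U) :
  invertible L -> V !=set0 -> mres h s = 0 -> s = 0.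
Proof.
move=> invL V0 s0; apply: msec_local => x Ux.
have [W [e [Wx ge]]] := invL x.
pose D := opensI U W; have DU : D `<=` U by apply: subIsetl.
have DW : D `<=` W by apply: subIsetr.
exists D, DU; split=> //; rewrite mres0.
have [a aE] := gen_ex ge DW (mres DU s).
have [|y [Dy Vy]] := @integral_meet D V _ V0; first by exists x.
pose N := opensI D V; have ND : N `<=` D by apply: subIsetl.
have NV : N `<=` V by apply: subIsetr.
rewrite aE; suff -> : a = 0 by rewrite scale0r.
apply: (@sec_res_inj D N ND); first by exists y.
apply: (@gen_inj _ L W e ge N (subset_trans ND DW)); rewrite scale0r -mres_res -mresZ -aE.
by rewrite mres_res (mres_irr _ (subset_trans NV h)) -mres_res s0 mres0.
Qed.

End Integral.

(** * Isomorphisms of sheaves of modules *)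

Section SheafIso.
Variable X : ringedSpace.
Implicit Types (F G : modSheaf X) (U V : opens X).

Lemma linear_bundle (R : pzRingType) (V W : lmodType R) (f : V -> W) :
  linear f -> exists g : {linear V -> W}, g =1 f.
Proof.
move=> lf; pose m := GRing.isLinear.Build R V W *:%R f lf.
by exists (HB.pack f m : {linear V -> W}).
Qed.

(** [Rel] is the graph of a morphism of sheaves. Since 0 is related only to 0, linearity makes
    images unique, and unique local images glue. *)
Lemma rel_solve F G (Rel : forall U, msec F U -> msec G U -> Prop) :
  (forall U a s s' t t', Rel U s t -> Rel U s' t' ->
     Rel U (a *: s + s') (a *: t + t')) ->
  (forall U V (h : V `<=` U) s t, Rel U s t -> Rel V (mres h s) (mres h t)) ->
  (forall U s t, (forall x, oset U x -> exists V (h : V `<=` U),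
     oset V x /\ Rel V (mres h s) (mres h t)) -> Rel U s t) ->
  (forall U t, Rel U 0 t -> t = 0) ->
  (forall x, exists U, oset U x /\
     forall V, V `<=` U -> forall s, exists t, Rel V s t) ->
  forall U s, exists! t, Rel U s t.
Proof.
move=> Rlin Rres Rloc R0 Rex.
have Runiq U s t t' : Rel U s t -> Rel U s t' -> t = t'.
  move=> h h'; apply/eqP; rewrite eq_sym -subr_eq0; apply/eqP/(R0 U).
  by have := Rlin U (-1) _ _ _ _ h h'; rewrite !scaleN1r addNr addrC.
move=> U s.
have [|||t tP] := @msec_solve X G U (fun V h t => Rel V (mres h s) t).
- by move=> V W h h' hW t /(Rres _ _ h'); rewrite mres_res (mres_irr _ hW).
- by move=> V h t t'; apply: Runiq.
- move=> x Ux; have [V [Vx VP]] := Rex x.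
  exists (opensI U V), (@subIsetl _ _ _); split=> //.
  by apply: VP; apply: subIsetr.
exists t; split; last by move=> t'; apply: Runiq; apply: Rloc.
exact: Rloc.
Qed.

(** An isomorphism given by its graph: solving the relation in both directions yields inverse maps,
    and uniqueness of solutions yields linearity and compatibility with restriction. *)
Lemma sheaf_iso_rel F G (Rel : forall U, msec F U -> msec G U -> Prop) :
  (forall U a s s' t t', Rel U s t -> Rel U s' t' ->
     Rel U (a *: s + s') (a *: t + t')) ->
  (forall U V (h : V `<=` U) s t, Rel U s t -> Rel V (mres h s) (mres h t)) ->
  (forall U s t, (forall x, oset U x -> exists V (h : V `<=` U),
     oset V x /\ Rel V (mres h s) (mres h t)) -> Rel U s t) ->
  (forall U t, Rel U 0 t -> t = 0) ->
  (forall U s, Rel U s 0 -> s = 0) ->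
  (forall x, exists U, oset U x /\
     forall V, V `<=` U -> forall s, exists t, Rel V s t) ->
  (forall x, exists U, oset U x /\
     forall V, V `<=` U -> forall t, exists s, Rel V s t) ->
  sheaf_iso F G.
Proof.
move=> Rlin Rres Rloc R0t R0s Rext Rexs.
have st := rel_solve Rlin Rres Rloc R0t Rext.
have ts := @rel_solve G F (fun U t s => Rel U s t)
  (fun U a s s' t t' => Rlin U a t t' s s') (fun U V h s t => Rres U V h t s)
  (fun U s t => Rloc U t s) R0s Rexs.
pose f U s := projT1 (cid (st U s)).
have fP U s : Rel U s (f U s) by rewrite /f; case: cid => t [].
have fu U s t : Rel U s t -> f U s = t by rewrite /f; case: cid => t' [] /= _; apply.
have lf U : linear (f U).
  by move=> a s s'; apply: fu; apply: Rlin; apply: fP.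
pose phi U := projT1 (cid (linear_bundle (lf U))).
have phiE U : phi U =1 f U by rewrite /phi; case: cid.
exists phi; split=> [U|U V h s]; last by rewrite !phiE; apply: fu; apply: Rres.
pose g t := projT1 (cid (ts U t)).
have gP t : Rel U (g t) t by rewrite /g; case: cid => s [].
have gu s t : Rel U s t -> g t = s by rewrite /g; case: cid => t' [] /= _; apply.
exists g => [s|t]; first by rewrite phiE; apply: gu.
by rewrite phiE; apply: fu.
Qed.

Lemma sheaf_iso_refl F : sheaf_iso F F.
Proof.
by exists (fun U => idfun : {linear msec F U -> msec F U}).
Qed.

Lemma sheaf_iso_sym F G : sheaf_iso F G -> sheaf_iso G F.
Proof.
move=> [phi [phib phir]].
apply: (@sheaf_iso_rel G F (fun U t s => t = phi U s)).
- by move=> U a t t' s s' -> ->; rewrite linearP.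
- by move=> U V h t s ->; rewrite phir.
- move=> U t s loc; apply: msec_local => x /loc[V [h [Vx e]]].
  by exists V, h; rewrite e phir.
- move=> U s e; apply: (bij_inj (phib U)); by rewrite -e linear0.
- by move=> U t ->; rewrite linear0.
- move=> x; exists (openT X); split=> // V _ t; have [psi _ phiK] := phib V.
  by exists (psi t).
- by move=> x; exists (openT X); split=> // V _ s; exists (phi V s).
Qed.

Lemma sheaf_iso_trans F G H : sheaf_iso F G -> sheaf_iso G H -> sheaf_iso F H.
Proof.
move=> [phi [phib phir]] [psi [psib psir]].
exists (fun U => (psi U \o phi U)%FUN : {linear msec F U -> msec H U}); split.
  by move=> U; exact: (bij_comp (psib U) (phib U)).
by move=> U V h s /=; rewrite phir psir.
Qed.

Lemma sheaf_iso_gen F G (phi : forall U, {linear msec F U -> msec G U}) :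
  (forall U, bijective (phi U)) ->
  (forall U V (h : V `<=` U) s, phi V (mres h s) = mres h (phi U s)) ->
  forall U (e : msec F U), is_gen e -> is_gen (phi U e).
Proof.
move=> phib phir U e ge V h t; have [psi phiK psiK] := phib V.
have [a [ae au]] := ge V h (psi t).
exists a; split; first by rewrite -phir -linearZ /= -ae psiK.
move=> b; rewrite -phir -linearZ /= => /(congr1 psi); rewrite phiK.
exact: au.
Qed.

Lemma sheaf_iso_invertible F G : sheaf_iso F G -> invertible F -> invertible G.
Proof.
move=> [phi [phib phir]] invF x; have [U [e [Ux ge]]] := invF x.
by exists U, (phi U e); split=> //; apply: sheaf_iso_gen.
Qed.

Lemma pic_mem_invertible (c : Pic X) F : pic_mem c F -> invertible F.
Proof.
rewrite /pic_mem; case: c => c /= [L [invL ->]] /sheaf_iso_invertible; exact.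
Qed.

Lemma pic_mem_iso (c : Pic X) F G : pic_mem c F -> sheaf_iso F G -> pic_mem c G.
Proof.
rewrite /pic_mem; case: c => c /= [L [invL ->]]; exact: sheaf_iso_trans.
Qed.

Lemma pic_eq (c d : Pic X) F G :
  pic_mem c F -> pic_mem d G -> sheaf_iso F G -> c = d.
Proof.
move=> cF dG FG; have {FG} cG := pic_mem_iso cF FG.
have : sval c = sval d.
  move: cG dG; rewrite /pic_mem.
  case: c cF => c /= [L [invL ->]] _; case: d => d /= [L' [invL' ->]] LG L'G.
  apply: funext => H; apply: propext; split.
    apply: sheaf_iso_trans; apply: sheaf_iso_trans L'G _; exact: sheaf_iso_sym.
  apply: sheaf_iso_trans; apply: sheaf_iso_trans LG _; exact: sheaf_iso_sym.
case: c d {cF cG dG} => [c hc] [d hd] /= e.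
case: d / e hd => hd; by rewrite (Prop_irrelevance hc hd).
Qed.

End SheafIso.

(** * Zero divisors of sections *)

Section Divisors.
Variable X : scheme.
Hypothesis intX : integral_scheme X.
Implicit Types (F G H L : modSheaf X) (U V W : opens X).

(** A nonzero section stays nonzero on every nonempty open, hence so does its coefficient [b], and
    the sections there form a domain. Over the empty open all sections agree. *)
Lemma coef_regular L (s : msec L (openT X)) U (e : msec L U) b :
  invertible L -> s <> 0 -> is_gen e -> mres (@subT _ U) s = b *: e ->
  forall V (h : V `<=` U) a, a * res h b = 0 -> a = 0.
Proof.
move=> invL s0 ge sE V h a ab.
have [V0|V0] := pselect (V !=set0); last first.
  by apply: sec_local => x Vx; case: V0; exists x.
have [//|b0] := integral_mul0 intX V0 ab.
case: s0; apply: (@msec_res_inj X intX L (openT X) V (@subT _ V)) => //.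
rewrite (mres_irr _ (subset_trans h (@subT _ U))) -mres_res sE mresZ b0.
by rewrite scale0r.
Qed.

(** This makes quotients by the section [s] unique. *)
Lemma scale_section_inj L (s : msec L (openT X)) U (d : sec U) :
  invertible L -> s <> 0 -> d *: mres (@subT _ U) s = 0 -> d = 0.
Proof.
move=> invL s0 ds; apply: sec_local => x Ux; have [W [e [Wx ge]]] := invL x.
pose V := opensI U W; have VU : V `<=` U by apply: subIsetl.
have VW : V `<=` W by apply: subIsetr.
exists V, VU; split=> //; rewrite rmorph0.
have [b bE] := gen_ex1 (gen_res VW ge) (mres (@subT _ V) s).
apply: (@coef_regular L s V _ b invL s0 (gen_res VW ge) bE V (@subset_refl _ V)).
rewrite res_id; apply: (gen_inj1 (gen_res VW ge)); rewrite scale0r -scalerA -bE.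
have := congr1 (mres VU) ds; rewrite mresZ mres_res mres0 => <-.
by congr (_ *: _); apply: mres_irr.
Qed.

Lemma zero_div_res L (s : msec L (openT X)) U V (h : V `<=` U) a :
  zero_div s a -> zero_div s (res h a).
Proof.
move=> sa x Vx; have [W [hW [hT [e [b [Wx ge sE [d dE]]]]]]] := sa x (h x Vx).
pose N := opensI V W; have NV : N `<=` V by apply: subIsetl.
have NW : N `<=` W by apply: subIsetr.
exists N, NV, (@subT _ N), (mres NW e), (res NW b); split=> //.
- exact: gen_res.
- by rewrite -mresZ -sE mres_res; apply: mres_irr.
- exists (res NW d); rewrite -rmorphM -dE !res_res; exact: res_irr.
Qed.

(** Any single chart computes the zero divisor: a change of generator multiplies the coefficient by
    a function, and the local cofactors glue since they are unique, [b] being regular. *)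
Lemma zero_divP L (s : msec L (openT X)) U (e : msec L U) b a :
  invertible L -> s <> 0 -> is_gen e -> mres (@subT _ U) s = b *: e ->
  zero_div s a <-> exists d, a = d * b.
Proof.
move=> invL s0 ge sE; split; last first.
  move=> [d dE] x Ux; exists U, (@subset_refl _ U), (@subT _ U), e, b; split=> //.
  by exists d; rewrite res_id.
move=> sa.
have [|||d dP] := @msec_solve X (structure_sheaf X) U
    (fun V h (d : sec V) => res h a = d * res h b).
- move=> V W h h' hW d /(congr1 (res h')); rewrite rmorphM !res_res.
  by rewrite !(res_irr _ hW).
- move=> V h c d c1 d1; apply/eqP; rewrite -subr_eq0; apply/eqP.
  apply: (@coef_regular L s U e b invL s0 ge sE V h).
  by rewrite mulrBl -c1 -d1 subrr.
- move=> x Ux; have [V [h [hT [e' [b' [Vx ge' sE' [d dE]]]]]]] := sa x Ux.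
  exists V, h; split=> //; have [u uE] := gen_ex1 ge' (mres h e).
  exists (d * u); rewrite dE -mulrA; congr (_ * _).
  apply: (gen_inj1 ge'); rewrite -sE' mulrC -scalerA -uE -mresZ -sE mres_res.
  exact: mres_irr.
exists d; apply: sec_local => x /dP[V [h [Vx e1]]].
by exists V, h; split=> //; rewrite e1 rmorphM.
Qed.

Lemma section_chart L (s : msec L (openT X)) x W : invertible L -> oset W x ->
  exists U (e : msec L U) b,
    [/\ oset U x, U `<=` W, is_gen e & mres (@subT _ U) s = b *: e].
Proof.
move=> invL Wx; have [U [e [Ux ge]]] := invL x.
have h : opensI U W `<=` U by apply: subIsetl.
have [b bE] := gen_ex1 (gen_res h ge) (mres (@subT _ _) s).
exists (opensI U W), (mres h e), b; split=> //; [exact: subIsetr|exact: gen_res].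
Qed.

Lemma zero_div_ideal L (s : msec L (openT X)) :
  invertible L -> s <> 0 -> ideal_sheaf (zero_div s).
Proof.
move=> invL s0.
have loc U (a : sec U) : (forall x, oset U x -> exists V (h : V `<=` U),
    oset V x /\ zero_div s (res h a)) -> zero_div s a.
  move=> la x Ux; have [V [h [Vx Va]]] := la x Ux.
  have [W [hW [hT [e [b [Wx ge sE [d dE]]]]]]] := Va x Vx.
  exists W, (subset_trans hW h), hT, e, b; split=> //.
  by exists d; rewrite -dE res_res.
split=> //.
- move=> U; apply: loc => x Ux.
  have [V [e [b [Vx VU ge sE]]]] := section_chart s invL Ux.
  exists V, VU; split=> //; apply/(zero_divP _ invL s0 ge sE).
  by exists 0; rewrite mul0r rmorph0.
- move=> U a a' sa sa'; apply: loc => x Ux.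
  have [V [e [b [Vx VU ge sE]]]] := section_chart s invL Ux.
  exists V, VU; split=> //; apply/(zero_divP _ invL s0 ge sE).
  have /(zero_divP _ invL s0 ge sE)[d dE] := zero_div_res VU sa.
  have /(zero_divP _ invL s0 ge sE)[d' d'E] := zero_div_res VU sa'.
  by exists (d + d'); rewrite rmorphD dE d'E mulrDl.
- move=> U a a' sa'; apply: loc => x Ux.
  have [V [e [b [Vx VU ge sE]]]] := section_chart s invL Ux.
  exists V, VU; split=> //; apply/(zero_divP _ invL s0 ge sE).
  have /(zero_divP _ invL s0 ge sE)[d' d'E] := zero_div_res VU sa'.
  by exists (res VU a * d'); rewrite rmorphM d'E mulrA.
- by move=> U V h a; apply: zero_div_res.
Qed.

Lemma zero_div_cartier L (s : msec L (openT X)) :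
  invertible L -> s <> 0 -> eff_cartier (zero_div s).
Proof.
move=> invL s0; split; first exact: zero_div_ideal.
move=> x; have [U [e [b [Ux _ ge sE]]]] := section_chart s invL (I : oset (openT X) x).
exists U, b; split=> // V h; split.
  exact: (coef_regular invL s0 ge sE).
move=> a; apply: (zero_divP _ invL s0 (gen_res h ge)).
by rewrite -mresZ -sE mres_res; apply: mres_irr.
Qed.

(** In a chart the coefficient of the product is the product of the coefficients, taken in a
    domain. *)
Lemma pairing_neq0 F G H (mu : pairing F G H) s t :
  invertible F -> invertible G -> perfect mu -> s <> 0 -> t <> 0 ->
  mu (openT X) s t <> 0.
Proof.
move=> invF invG pmu s0 t0 mu0; have [x _] := intX.1.
have [U [e [a [Ux _ ge sE]]]] := section_chart s invF (I : oset (openT X) x).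
have [V [e' [b [Vx VU ge' tE]]]] := section_chart t invG Ux.
have V0 : V !=set0 by exists x.
have := congr1 (mres (@subT _ V)) mu0.
rewrite pair_res mres0 tE pairZr.
rewrite (mres_irr _ (subset_trans VU (@subT _ U))) -mres_res sE mresZ pairZl.
rewrite -(scale0r (mu _ (mres VU e) e')) scalerA.
move=> /(gen_inj1 (pmu _ _ _ (gen_res VU ge) ge')) /(integral_mul0 intX V0)[].
- move=> b0; apply: t0; apply: (@msec_res_inj X intX _ (openT X) V (@subT _ V)) => //.
  by rewrite tE b0 scale0r.
- move=> a0; apply: s0; apply: (@msec_res_inj X intX _ (openT X) V (@subT _ V)) => //.
  rewrite (mres_irr _ (subset_trans VU (@subT _ U))) -mres_res sE mresZ a0.
  by rewrite scale0r.
Qed.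

Lemma gen_sheaf_iso L (e : msec L (openT X)) :
  is_gen e -> sheaf_iso (structure_sheaf X) L.
Proof.
move=> ge.
apply: (@sheaf_iso_rel X (structure_sheaf X) L
  (fun U (a : sec U) t => t = a *: mres (@subT _ U) e)).
- by move=> U a b b' t t' -> ->; rewrite scalerDl scalerA.
- move=> U V h b t ->; rewrite mresZ mres_res.
  by congr (_ *: _); apply: mres_irr.
- move=> U b t loc; apply: msec_local => x /loc[V [h [Vx E]]].
  exists V, h; split=> //; rewrite E mresZ mres_res.
  by congr (_ *: _); apply: mres_irr.
- by move=> U t ->; rewrite scale0r.
- move=> U b /esym; rewrite -(scale0r (mres (@subT _ U) e)).
  exact: (gen_inj ge).
- by move=> x; exists (openT X); split=> // V _ b; exists (b *: mres (@subT _ V) e).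
- by move=> x; exists (openT X); split=> // V h t; apply: (gen_ex ge).
Qed.

End Divisors.

(** * Divisor classes *)

Section IdealSections.
Variables (X : ringedSpace) (I : ideals X) (hI : ideal_sheaf I).
Implicit Types U V : opens X.

Definition to_ideal U (a : sec U) (Ia : I a) : msec (ideal_module hI) U :=
  IdealSec (mem_set Ia : a \in ideal_pred hI).

Definition of_ideal U (a : msec (ideal_module hI) U) : sec U := ideal_val a.

Lemma of_idealP U (a : msec (ideal_module hI) U) : I (of_ideal a).
Proof. exact: ideal_secP. Qed.

Lemma of_ideal_inj U : injective (@of_ideal U).
Proof. by move=> a b; apply: val_inj. Qed.

Lemma of_idealK U (a : sec U) (Ia : I a) : of_ideal (to_ideal Ia) = a.
Proof. by []. Qed.

Lemma of_idealD U (a b : msec (ideal_module hI) U) :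
  of_ideal (a + b) = of_ideal a + of_ideal b.
Proof. by []. Qed.

Lemma of_idealZ U c (a : msec (ideal_module hI) U) :
  of_ideal (c *: a) = c * of_ideal a.
Proof. by []. Qed.

Lemma of_ideal_res U V (h : V `<=` U) (a : msec (ideal_module hI) U) :
  of_ideal (mres h a) = res h (of_ideal a).
Proof. by []. Qed.

Lemma ideal_module_invertible : eff_cartier I -> invertible (ideal_module hI).
Proof.
move=> [_ cI] x; have [U [f [Ux fP]]] := cI x.
have If : I f.
  have [_ /(_ f) H] := fP U (@subset_refl _ U).
  by apply/H; exists 1; rewrite mul1r res_id.
exists U, (to_ideal If); split=> // V h s.
have [reg gen] := fP V h.
have [b bE] := (gen _).1 (of_idealP s).
exists b; split; first by apply: of_ideal_inj; rewrite bE.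
move=> c /(congr1 (@of_ideal V)); rewrite bE of_idealZ of_ideal_res of_idealK.
move=> E; apply/eqP; rewrite -subr_eq0; apply/eqP/reg.
by rewrite mulrBl E subrr.
Qed.

End IdealSections.

Section DivisorClass.
Variable X : scheme.
Hypothesis intX : integral_scheme X.
Implicit Types (F G H L : modSheaf X) (U V W : opens X).

Section Existence.
Variables (L : modSheaf X) (s : msec L (openT X)).
Hypotheses (invL : invertible L) (s0 : s <> 0).
Let hI := zero_div_ideal intX invL s0.

(** The function [a t / s], regular because [a] is locally a multiple of the coefficient of [s]. It
    is the multiplication map of O(D) and O(-D) into the structure sheaf, with [L] in the place of
    O(D). *)
Lemma zero_div_quot U (t : msec L U) (a : sec U) :
  zero_div s a -> exists d, d *: mres (@subT _ U) s = a *: t.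
Proof.
move=> sa.
have [|||d dP] := @msec_solve X (structure_sheaf X) U
    (fun V h (d : sec V) => d *: mres (@subT _ V) s = res h a *: mres h t).
- move=> V W h h' hW d /(congr1 (mres h')).
  by rewrite !mresZ !mres_res res_res !(mres_irr _ hW) (res_irr _ hW)
    (mres_irr _ (@subT _ W)).
- move=> V h c d c1 d1; apply/eqP; rewrite -subr_eq0; apply/eqP.
  apply: (@scale_section_inj X intX L s V (c - d) invL s0).
  by rewrite scalerBl c1 d1 subrr.
- move=> x Ux; have [V [e [b [Vx VU ge sE]]]] := section_chart s invL Ux.
  exists V, VU; split=> //.
  have /(zero_divP intX _ invL s0 ge sE)[d dE] := zero_div_res VU sa.
  have [c cE] := gen_ex1 ge (mres VU t).
  by exists (d * c); rewrite sE dE cE !scalerA; congr (_ *: _); rewrite mulrAC.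
exists d; apply: msec_local => x /dP[V [h [Vx E]]].
exists V, h; split=> //; rewrite !mresZ -E mres_res.
by congr (_ *: _); apply: mres_irr.
Qed.

Let quot U (t : msec L U) (a : msec (ideal_module hI) U) : (sec U)^o :=
  projT1 (cid (zero_div_quot t (of_idealP a))).

Lemma quotP U (t : msec L U) (a : msec (ideal_module hI) U) d :
  (d *: mres (@subT _ U) s = of_ideal a *: t) <-> quot t a = d.
Proof.
rewrite /quot; case: cid => c /= cE; split=> [dE|<- //].
apply/eqP; rewrite -subr_eq0; apply/eqP.
apply: (@scale_section_inj X intX L s U (c - d) invL s0).
by rewrite scalerBl cE dE subrr.
Qed.

Let quotE U (t : msec L U) (a : msec (ideal_module hI) U) :
  (quot t a : sec U) *: mres (@subT _ U) s = of_ideal a *: t.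
Proof. exact/quotP. Qed.

Definition zero_div_pairing :
  pairing L (ideal_module hI) (structure_sheaf X).
Proof.
refine (@Pairing X L (ideal_module hI) (structure_sheaf X) quot _ _ _ _ _).
- by move=> U t t' a; apply/quotP; rewrite scalerDl !quotE scalerDr.
- by move=> U t a a'; apply/quotP; rewrite scalerDl !quotE of_idealD scalerDl.
- move=> U c t a; apply/quotP.
  by rewrite -[LHS]scalerA quotE !scalerA mulrC.
- move=> U c t a; apply/quotP.
  by rewrite -[LHS]scalerA quotE !scalerA of_idealZ.
- move=> U V h t a; apply/esym/quotP.
  rewrite of_ideal_res -mresZ -quotE mresZ mres_res.
  by congr (_ *: _); apply: mres_irr.
Defined.

(** Let [s = b e]. The coefficient [b] lies in the ideal, so [b = a e'], while the quotient
    [q = e' e / s] satisfies [q b = e']. Hence [a q b = b], and [q] is a unit because [b] is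
    regular. *)
Lemma zero_div_perfect : perfect zero_div_pairing.
Proof.
move=> U e e' ge ge' V h d.
have [b bE] := gen_ex1 ge (mres (@subT _ U) s).
have sb : zero_div s b.
  by apply/(zero_divP intX _ invL s0 ge bE); exists 1; rewrite mul1r.
have [a aE] := gen_ex1 ge' (to_ideal hI sb).
have q : (quot e e' : sec U) * b = of_ideal e'.
  by apply: (gen_inj1 ge); rewrite -scalerA -bE quotE.
have /(congr1 (@of_ideal _ _ hI U)) := aE; rewrite of_idealK of_idealZ => bE'.
have u : a * quot e e' = 1.
  apply/eqP; rewrite -subr_eq0; apply/eqP.
  apply: (@coef_regular X intX L s U e b invL s0 ge bE U (@subset_refl _ U)).
  by rewrite res_id mulrBl mul1r -mulrA q -bE' subrr.
exists (d * res h a); split.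
  by rewrite /= -[RHS]mulrA -rmorphM u rmorph1 mulr1.
by move=> c -> /=; rewrite -[LHS]mulrA -rmorphM [_ * a]mulrC u rmorph1 mulr1.
Qed.

Lemma div_class_zero_div (c : Pic X) : pic_mem c L -> div_class (zero_div s) c.
Proof.
move=> cL; exists hI, L; split=> //.
by exists zero_div_pairing; apply: zero_div_perfect.
Qed.

End Existence.

(** Inverses are unique: sections of [F] and [F'] correspond when they pair equally with all local
    sections of [G]. *)
Lemma pairing_iso (F F' G : modSheaf X)
    (mu : pairing F G (structure_sheaf X)) (mu' : pairing F' G (structure_sheaf X)) :
  invertible F -> invertible F' -> invertible G -> perfect mu -> perfect mu' ->
  sheaf_iso F F'.
Proof.
move=> invF invF' invG pmu pmu'.
(* If [m1(e1, w) = d m2(e2, w)] for local generators, then [c e1] corresponds to [c d e2]. *)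
have loc F1 F2 (m1 : pairing F1 G (structure_sheaf X))
    (m2 : pairing F2 G (structure_sheaf X)) : invertible F1 -> invertible F2 ->
    perfect m1 -> perfect m2 ->
    forall x, exists U, oset U x /\ forall V, V `<=` U -> forall t1, exists t2,
      forall W (h : W `<=` V) (a : msec G W), m1 W (mres h t1) a = m2 W (mres h t2) a.
  move=> invF1 invF2 p1 p2 x.
  have [U1 [e1 [U1x ge1]]] := invF1 x; have [U2 [e2 [U2x ge2]]] := invF2 x.
  have [U3 [w [U3x gw]]] := invG x.
  exists (opensI U1 (opensI U2 U3)); split=> // V hV t1.
  have h1 : V `<=` U1 by move=> y /hV[].
  have h2 : V `<=` U2 by move=> y /hV[_ []].
  have h3 : V `<=` U3 by move=> y /hV[_ []].
  have g1 := gen_res h1 ge1; have g2 := gen_res h2 ge2; have g3 := gen_res h3 gw.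
  have [c cE] := gen_ex1 g1 t1.
  have [d dE] := gen_ex1 (p2 _ _ _ g2 g3) (m1 V (mres h1 e1) (mres h3 w)).
  exists ((c * d) *: mres h2 e2) => W h a.
  have [b ->] := gen_ex g3 h a.
  rewrite !pairZr -!pair_res; congr (_ *: mres h _).
  by rewrite cE !pairZl dE scalerA.
have inj0 F1 (m1 : pairing F1 G (structure_sheaf X)) : invertible F1 ->
    perfect m1 -> forall U t,
    (forall W (h : W `<=` U) (a : msec G W), m1 W (mres h t) a = 0) -> t = 0.
  move=> invF1 p1 U t t0; apply: msec_local => x Ux.
  have [U1 [e1 [U1x ge1]]] := invF1 x.
  have [U3 [w [U3x gw]]] := invG x.
  pose V := opensI U (opensI U1 U3).
  have h : V `<=` U by apply: subIsetl.
  have h1 : V `<=` U1 by move=> y [_ []].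
  have h3 : V `<=` U3 by move=> y [_ []].
  have g1 := gen_res h1 ge1; have g3 := gen_res h3 gw.
  exists V, h; split=> //; have [c cE] := gen_ex1 g1 (mres h t).
  have := t0 V h (mres h3 w); rewrite cE pairZl.
  rewrite -(scale0r (m1 V (mres h1 e1) (mres h3 w))) => /(gen_inj1 (p1 _ _ _ g1 g3)) ->.
  by rewrite scale0r mres0.
have pair0 F1 (m1 : pairing F1 G (structure_sheaf X)) U a : m1 U 0 a = 0.
  by rewrite -(scale0r (0 : msec F1 U)) pairZl scale0r.
apply: (@sheaf_iso_rel X F F' (fun U t t' => forall W (h : W `<=` U) (a : msec G W),
    mu W (mres h t) a = mu' W (mres h t') a)).
- move=> U c t1 t2 t1' t2' H1 H2 W h a.
  by rewrite !mresD !mresZ !pairDl !pairZl H1 H2.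
- by move=> U V h t t' Htt' W hW a; rewrite !mres_res; apply: Htt'.
- move=> U t t' Hl W h a; apply: (@msec_local X (structure_sheaf X)) => x Wx.
  have [V [hV [Vx HV]]] := Hl x (h x Wx).
  have hW : opensI V W `<=` W by apply: subIsetr.
  have hV' : opensI V W `<=` V by apply: subIsetl.
  exists (opensI V W), hW; split=> //; rewrite !pair_res.
  have := HV _ hV' (mres hW a); rewrite !mres_res.
  by rewrite !(mres_irr (subset_trans hV' hV) (subset_trans hW h)).
- move=> U t' Ht'; apply: (inj0 _ _ invF' pmu') => W h a.
  by rewrite -Ht' mres0 pair0.
- move=> U t Ht; apply: (inj0 _ _ invF pmu) => W h a.
  by rewrite Ht mres0 pair0.
- exact: loc.
- move=> x; have [U [Ux UP]] := loc _ _ mu' mu invF' invF pmu' pmu x.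
  exists U; split=> // V h t'; have [t tP] := UP V h t'.
  by exists t => W hW a; rewrite tP.
Qed.

Lemma div_class_uniq (I : ideals X) (c d : Pic X) :
  eff_cartier I -> div_class I c -> div_class I d -> c = d.
Proof.
move=> cI [hI [L [cL [mu pmu]]]] [hI' [L' [dL' [mu' pmu']]]].
rewrite (Prop_irrelevance hI' hI) in mu' pmu' *.
apply: (pic_eq cL dL').
apply: (pairing_iso (pic_mem_invertible cL) (pic_mem_invertible dL') _ pmu pmu').
exact: ideal_module_invertible.
Qed.

End DivisorClass.

(** * Sums of ideal sheaves and of sections *)

Section IdealSums.
Variables (X : scheme) (n : nat).
Implicit Types (U V W : opens X) (H : 'I_n -> ideals X).

Lemma ideal_sum (I : ideals X) U (J : finType) (a : J -> sec U) :
  ideal_sheaf I -> (forall j, I U (a j)) -> I U (\sum_j a j).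
Proof. by case=> I0 ID _ _ _ Ia; apply: big_ind => //; apply: ID. Qed.

Lemma sum_ideals_ideal H :
  (forall j, ideal_sheaf (H j)) -> ideal_sheaf (sum_ideals H).
Proof.
move=> iH.
have rH j U V (h : V `<=` U) a : H j U a -> H j V (res h a).
  by have [_ _ _ HR _] := iH j; apply: HR.
split.
- move=> U x Ux; exists U, (@subset_refl _ U); split=> //.
  exists (fun=> 0); split; last by rewrite rmorph0 big1.
  by move=> j; case: (iH j).
- move=> U a a' Ia Ia' x Ux.
  have [V [h [Vx [b [bP bE]]]]] := Ia x Ux.
  have [V' [h' [V'x [b' [b'P b'E]]]]] := Ia' x Ux.
  have hV : opensI V V' `<=` V by apply: subIsetl.
  have hV' : opensI V V' `<=` V' by apply: subIsetr.
  exists (opensI V V'), (subset_trans hV h); split=> //.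
  exists (fun j => res hV (b j) + res hV' (b' j)); split.
    by move=> j /=; have [_ HD _ _ _] := iH j; apply: HD; apply: rH.
  rewrite rmorphD -res_res bE [in X in _ + X](res_irr _ (subset_trans hV' h')).
  by rewrite -(res_res h') b'E !rmorph_sum big_split.
- move=> U c a Ia x Ux.
  have [V [h [Vx [b [bP bE]]]]] := Ia x Ux.
  exists V, h; split=> //; exists (fun j => res h c * b j); split.
    by move=> j; case: (iH j) => _ _ + _ _; apply.
  by rewrite rmorphM bE mulr_sumr.
- move=> U V h a Ia x Vx.
  have [W [hW [Wx [b [bP bE]]]]] := Ia x (h x Vx).
  have hV : opensI V W `<=` V by apply: subIsetl.
  have hW' : opensI V W `<=` W by apply: subIsetr.
  exists (opensI V W), hV; split=> //; exists (fun j => res hW' (b j)); split.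
    by move=> j; apply: rH.
  by rewrite -rmorph_sum -bE !res_res; apply: res_irr.
- move=> U a la x Ux; have [V [h [Vx Va]]] := la x Ux.
  have [W [hW [Wx [b [bP bE]]]]] := Va x Vx.
  exists W, (subset_trans hW h); split=> //; exists b; split=> //.
  by rewrite -bE res_res.
Qed.

Lemma sum_ideals_min H (I : ideals X) : ideal_sheaf I ->
  (forall j U a, H j U a -> I U a) -> forall U (a : sec U), sum_ideals H a -> I U a.
Proof.
move=> iI HI U a Ha; have [_ _ _ _ loc] := iI.
apply: loc => x /Ha[V [h [Vx [b [bP bE]]]]]; exists V, h; split=> //.
by rewrite bE; apply: ideal_sum => // j; apply: HI.
Qed.

End IdealSums.

Section SectionSums.
Variable X : scheme.
Hypothesis intX : integral_scheme X.

(** Near a point where all the sheaves involved have generators, the coefficient of [s] is a linear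
    combination of the coefficients of the [t j]. *)
Lemma zero_div_sum (n : nat) (L : modSheaf X) (s : msec L (openT X))
    (G F : 'I_n -> modSheaf X) (mu : forall j, pairing (G j) (F j) L)
    (a : forall j, msec (G j) (openT X)) (t : forall j, msec (F j) (openT X)) :
  invertible L -> (forall j, invertible (F j)) ->
  s <> 0 -> (forall j, t j <> 0) ->
  s = \sum_(j < n) mu j (openT X) (a j) (t j) ->
  forall U (c : sec U), zero_div s c -> sum_ideals (fun j => zero_div (t j)) c.
Proof.
move=> invL invF s0 t0 sE U c sc x Ux.
have [V [e [b [Vx VU ge bE]]]] := section_chart s invL Ux.
have [||W [Wx WP]] := @common_nbhs X 'I_n x (fun j W =>
    exists (e' : msec (F j) W), is_gen e').
- move=> j W W' h [e' ge']; exists (mres h e'); exact: gen_res.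
- by move=> j; have [W [e' [Wx ge']]] := invF j x; exists W; split=> //; exists e'.
pose N := opensI V W; have NV : N `<=` V by apply: subIsetl.
have NW : N `<=` W by apply: subIsetr.
have NU := subset_trans NV VU.
have chart j : exists (q b' : sec N), zero_div (t j) b' /\
    mres (@subT _ N) (mu j (openT X) (a j) (t j)) = (q * b') *: mres NV e.
  have [e' /(gen_res NW) ge'] := WP j.
  have [b' b'E] := gen_ex1 ge' (mres (@subT _ N) (t j)).
  have [q qE] := gen_ex ge NV (mu j N (mres (@subT _ N) (a j)) (mres NW e')).
  exists q, b'; split.
    by apply/(zero_divP intX _ (invF j) (t0 j) ge' b'E); exists 1; rewrite mul1r.
  by rewrite pair_res b'E pairZr qE scalerA mulrC.
have /choice[q /choice[b' qP]] := chart.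
have /(zero_divP intX _ invL s0 ge bE)[d dE] := zero_div_res VU sc.
exists N, NU; split=> //; exists (fun j => res NV d * q j * b' j); split.
  move=> j; case: (zero_div_ideal intX (invF j) (t0 j)) => _ _ + _ _; apply.
  by have [] := qP j.
rewrite (res_irr NU (subset_trans NV VU)) -res_res dE rmorphM.
under eq_bigr do rewrite -mulrA.
rewrite -mulr_sumr; congr (_ * _).
apply: (@gen_inj _ L V e ge N NV); rewrite scaler_suml.
under eq_bigr => j _ do rewrite -(qP j).2.
rewrite -mres_sum -sE -mresZ -bE mres_res; exact: mres_irr.
Qed.

End SectionSums.

(** * The Galois action on the base change *)

Section Galois.
Variables (k K : fieldType) (i : {rmorphism k -> K}).

Definition galId : galois i :=
  @Galois k K i idfun idfun (fun=> erefl) (fun=> erefl) (fun=> erefl).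

Lemma galM_fix (g g' : galois i) a : (g \o g')%FUN (i a) = i a.
Proof. by rewrite /= !gal_fix. Qed.

Definition galM (g g' : galois i) : galois i :=
  @Galois k K i (g \o g')%FUN (gal_inv g' \o gal_inv g)%FUN (galM_fix g g')
    (can_comp (gal_funK g) (gal_funK g')) (can_comp (gal_invK g') (gal_invK g)).

Variables (Y : schemeOver k) (B : baseChange i Y).

Lemma galMor_id : eq_mor (galMor B galId) (@id_mor B).
Proof.
apply: eq_mor_sym; apply: galMor_unique; first exact: over_id.
exact: eq_mor_id.
Qed.

Lemma push_id (X : ringedSpace) (f : morphism X X) (F : modSheaf X) :
  eq_mor f (@id_mor X) -> sheaf_iso F (push f F).
Proof.
move=> [fid fres].
have h1 (U : opens X) : preimm f U `<=` U.
  by move=> x; rewrite /preimm/= /preimage/= (fid x).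
have h2 (U : opens X) : U `<=` preimm f U.
  by move=> x; rewrite /preimm/= /preimage/= (fid x).
have resE (U : opens X) (a : sec U) : res (h1 U) a = comor f U a.
  have := fres U (preimm f U) (@subset_refl _ _) (h1 U) a.
  by rewrite res_id /= res_res => ->; apply: res_irr.
pose phi U : msec F U -> msec (push f F) U := fun s => mres (h1 U) s.
have lphi U : linear (phi U) by move=> a s t; rewrite /phi mresD mresZ resE.
pose psi U := projT1 (cid (linear_bundle (lphi U))).
have psiE U : psi U =1 phi U by rewrite /psi; case: cid.
exists psi; split=> [U|U V h s]; last first.
  rewrite !psiE /phi [LHS]mres_res /= [RHS]mres_res; exact: mres_irr.
exists (fun t => mres (h2 U) (t : msec F (preimm f U))) => s; rewrite psiE /phi.
  by rewrite [LHS]mres_res (mres_irr _ (@subset_refl _ U)) mres_id.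
by rewrite [LHS]mres_res (mres_irr _ (@subset_refl _ (preimm f U))) mres_id.
Qed.

Lemma pic_act_id (c : Pic B) : pic_act galId c = c.
Proof.
rewrite /pic_act; case: cid => L /= [invL cE].
have cL : pic_mem c L by rewrite /pic_mem cE; apply: sheaf_iso_refl.
apply: (@pic_eq _ _ c (push (galMor B galId) L) L) => //.
  exact: sheaf_iso_refl.
by apply: sheaf_iso_sym; apply: push_id; apply: galMor_id.
Qed.

(** The ideal is generated by functions coming from [Y]. The inverse automorphism commutes with the
    projection to [Y], so it turns a local expression of the pullback of [a] into one of [a] with
    the same generators. *)
Lemma inv_ideal_galois (g : galois i) (J : ideals Y) U (a : sec U) :
  inv_ideal (bc_proj B) J (comor (galMor B g) U a) -> inv_ideal (bc_proj B) J a.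
Proof.
pose f := galMor B g; pose f' := galMor B (galV g).
have ff' : eq_mor (comp_mor f f') (@id_mor B).
  apply: galMorK; exact: gal_invK.
have pf' : eq_mor (comp_mor (bc_proj B) f') (bc_proj B) by apply: galMor_proj.
move=> Ia x Ux.
have Ux' : oset (preimm f U) (f' x).
  by rewrite /preimm/= /preimage/= [f (f' x)](ff'.1 x).
have [W [h [V [hV [n [b [c [Wx Jc E]]]]]]]] := Ia _ Ux'.
have h1 : preimm f' W `<=` U.
  by move=> y /h; rewrite /preimm/= /preimage/= [f (f' y)](ff'.1 y).
have h2 : preimm f' W `<=` preimm (bc_proj B) V.
  by move=> y /hV; rewrite /preimm/= /preimage/= [bc_proj B (f' y)](pf'.1 y).
exists (preimm f' W), h1, V, h2, n, (fun j => comor f' W (b j)), c; split=> //.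
have := congr1 (comor f' W) E.
have h3 : preimm f' W `<=` preimm f' (preimm f U) by move=> y /h.
have h4 : preimm f' W `<=` preimm f' (preimm (bc_proj B) V) by move=> y /hV.
rewrite (comor_res h h3) rmorph_sum.
have := ff'.2 U (preimm f' W) h3 h1 a; rewrite /= !res_res.
rewrite (res_irr _ h3) (res_irr _ h1) => -> ->.
apply: eq_bigr => j _; rewrite rmorphM (comor_res hV h4); congr (_ * _).
have := pf'.2 V (preimm f' W) h4 h2 (c j); rewrite /= res_res => <-.
exact: res_irr.
Qed.

End Galois.

(** * Galois descent *)

Section LinearAlgebra.
Variable K : fieldType.

(** Subspaces are predicates because the graded parts of the Cox ring may be
    infinite-dimensional. *)
Definition linear_sub (E : lmodType K) (V : E -> Prop) :=
  V 0 /\ forall a x y, V x -> V y -> V (a *: x + y).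

Lemma linear_subZ (E : lmodType K) (V : E -> Prop) a x :
  linear_sub V -> V x -> V (a *: x).
Proof. by move=> [V0 VD] Vx; rewrite -[_ *: _]addr0; apply: VD. Qed.

Lemma linear_subD (E : lmodType K) (V : E -> Prop) x y :
  linear_sub V -> V x -> V y -> V (x + y).
Proof. by move=> [_ VD] Vx Vy; rewrite -[x]scale1r; apply: VD. Qed.

Lemma linear_subB (E : lmodType K) (V : E -> Prop) x y :
  linear_sub V -> V x -> V y -> V (x - y).
Proof. by move=> [_ VD] Vx Vy; rewrite addrC -scaleN1r; apply: VD. Qed.

Lemma linear_sub_sum (E : lmodType K) (V : E -> Prop) (J : Type) (r : seq J)
    (P : pred J) (x : J -> E) :
  linear_sub V -> (forall j, P j -> V (x j)) -> V (\sum_(j <- r | P j) x j).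
Proof.
by move=> sV Vx; apply: big_ind => //; [case: sV | move=> y z; apply: linear_subD].
Qed.

Section Descent.
Variables (n : nat) (G : {rmorphism K -> K} -> Prop) (V : 'rV[K]_n -> Prop).
Hypothesis subV : linear_sub V.
Hypothesis stabV : forall g : {rmorphism K -> K}, G g -> forall v, V v -> V (map_mx g v).

Let supp (v : 'rV[K]_n) := [set t | v 0 t != 0]%SET.

(* A vector of minimal support with some coordinate 1 is fixed: its difference
   with a conjugate has smaller support. *)
Lemma fixed_vector v : V v -> v != 0 ->
  exists w t, [/\ V w, (forall g : {rmorphism K -> K}, G g -> map_mx g w = w),
    supp w \subset supp v & w 0 t = 1].
Proof.
have [m] := ubnP #|supp v|; elim: m v => // m IHm v ltm Vv v0.
have /rV0Pn[t vt] := v0.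
pose w := (v 0 t)^-1 *: v; have wt : w 0 t = 1 by rewrite mxE mulVf.
have Vw : V w by apply: linear_subZ.
have wv : supp w \subset supp v.
  by apply/fintype.subsetP => l; rewrite !inE mxE mulf_eq0 negb_or => /andP[].
have [fixw|] := pselect (forall g : {rmorphism K -> K}, G g -> map_mx g w = w).
  by exists w, t; split.
move=> /existsNP[g /not_implyP[Gg /eqP gw]].
pose u := map_mx g w - w.
have uv : supp u \proper supp v.
  apply/properP; split; last first.
    by exists t; rewrite !inE // !mxE mulVf // rmorph1 subrr eqxx.
  apply/fintype.subsetP => l; rewrite !inE; apply: contra => /eqP vl.
  by rewrite !mxE vl mulr0 rmorph0 subr0.
have [|||w' [t' [Vw' fw' sw' w't']]] := IHm u.
- by apply: leq_trans (proper_card uv) _; rewrite -ltnS.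
- by apply: linear_subB => //; apply: stabV.
- by rewrite subr_eq0.
exists w', t'; split=> //; exact: fintype.subset_trans sw' (proper_sub uv).
Qed.

(** Subtracting a multiple of a fixed vector supported inside the support of [v] kills a coordinate
    without creating new ones; induction on the size of the support. *)
Lemma fixed_vectors_span v : V v -> exists m (a : 'I_m -> K) (w : 'I_m -> 'rV[K]_n),
  (forall l, V (w l) /\ forall g : {rmorphism K -> K}, G g -> map_mx g (w l) = w l) /\
  v = \sum_(l < m) a l *: w l.
Proof.
have [m] := ubnP #|supp v|; elim: m v => // m IHm v ltm Vv.
have [->|v0] := eqVneq v 0.
  by exists 0%N, (fun=> 0), (fun=> 0); rewrite big_ord0; split=> // -[].
have [w [t [Vw fw sw wt]]] := fixed_vector Vv v0.
pose u := v - v 0 t *: w.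
have vt : t \in supp v by apply: (fintype.subsetP sw); rewrite inE wt oner_eq0.
have uv : supp u \proper supp v.
  apply/properP; split; last first.
    by exists t => //; rewrite !inE !mxE wt mulr1 subrr eqxx.
  apply/fintype.subsetP => l; rewrite !inE; apply: contra => /eqP vl.
  have /eqP wl0 : w 0 l == 0.
    by apply: contraT => wl; have := fintype.subsetP sw l; rewrite !inE wl vl eqxx => /(_ isT).
  by rewrite !mxE vl wl0 mulr0 subr0.
have [||p [a [w' [w'P uE]]]] := IHm u.
- by apply: leq_trans (proper_card uv) _; rewrite -ltnS.
- by apply: linear_subB => //; apply: linear_subZ.
exists p.+1, (fun l => oapp a (v 0 t) (unlift ord0 l)),
  (fun l => oapp w' w (unlift ord0 l)); split.
  by move=> l; case: unliftP => [l' _|_] /=; [exact: w'P | split].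
rewrite big_ord_recl unlift_none /=; under eq_bigr do rewrite liftK /=.
by rewrite -uE addrC subrK.
Qed.

End Descent.

(** Steinitz exchange modulo [V0], one index at a time, for a spanning family [v] that may be
    dependent. A redundant vector is replaced by any nonzero element of [S]; nonzero elements are
    wanted since each has to define a divisor. *)
Lemma exchange (E : lmodType K) (V V0 S : E -> Prop) (T : finType) (P : pred T)
    (v : T -> E) :
  linear_sub V -> linear_sub V0 -> (forall x, S x -> V x) ->
  (exists x, S x /\ x <> 0) ->
  (forall x, V x -> exists m (a : 'I_m -> K) (w : 'I_m -> E),
     (forall l, S (w l)) /\ x = \sum_(l < m) a l *: w l) ->
  (forall x, V x -> exists a, V0 (x - \sum_(t | P t) a t *: v t)) ->
  exists w : T -> E, (forall t, S (w t) /\ w t <> 0) /\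
    forall x, V x -> exists a, V0 (x - \sum_(t | P t) a t *: w t).
Proof.
move=> sV sV0 SV [s0 [Ss0 s00]] Sspan vspan.
suff [w [wS wspan]] : exists w : T -> E,
    (forall t, t \in enum T -> S (w t) /\ w t <> 0) /\
    forall x, V x -> exists a, V0 (x - \sum_(t | P t) a t *: w t).
  by exists w; split=> // t; apply: wS; rewrite mem_enum.
elim: (enum T) => [|t0 l [u [uS uspan]]]; first by exists v.
pose upd s t := if t == t0 then s else u t.
have updS s : S s -> s <> 0 ->
    forall t, t \in t0 :: l -> S (upd s t) /\ upd s t <> 0.
  move=> Ss sn0 t; rewrite inE /upd; case: eqVneq => //= _; exact: uS.
have upd_sum s a : ~~ P t0 \/ a t0 = 0 ->
    \sum_(t | P t) a t *: upd s t = \sum_(t | P t) a t *: u t.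
  move=> h; apply: eq_bigr => t Pt; rewrite /upd; case: eqVneq => // tt0.
  by case: h => h; [rewrite -tt0 Pt in h | rewrite tt0 h !scale0r].
have [Pt0|nPt0] := boolP (P t0); last first.
  exists (upd s0); split; first exact: updS.
  by move=> x /uspan[a aP]; exists a; rewrite upd_sum //; left.
(* Either some [s] in [S] cannot be expressed without [u t0], and then replaces it, or all of [S],
   hence all of [V], is expressed without [u t0]. *)
have [[s [Ss sP]]|nS] := pselect (exists s, S s /\
    forall a, V0 (s - \sum_(t | P t) a t *: u t) -> a t0 <> 0); last first.
  exists (upd s0); split; first exact: updS.
  move=> x /Sspan[m [a [w [wS ->]]]].
  have /choice[b bP] : forall l, exists b : T -> K,
      V0 (w l - \sum_(t | P t) b t *: u t) /\ b t0 = 0.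
    move=> l'; apply: contrapT => nb; apply: nS; exists (w l'); split=> // b bV b0.
    by apply: nb; exists b.
  exists (fun t => \sum_(l' < m) a l' * b l' t); rewrite upd_sum; last first.
    by right; rewrite big1 // => l' _; rewrite (bP l').2 mulr0.
  under [X in _ - X]eq_bigr do rewrite scaler_suml.
  rewrite exchange_big -sumrB; apply: linear_sub_sum => // l' _.
  under [X in _ - X]eq_bigr do rewrite -scalerA.
  by rewrite -scaler_sumr -scalerBr; apply: linear_subZ => //; case: (bP l').
have [a aV] := uspan _ (SV _ Ss); have /eqP at0 := sP _ aV.
exists (upd s); split.
  (* If [s] were 0, the expression with all coefficients 0 would avoid [u t0]. *)
  apply: updS => // se; apply: (sP (fun=> 0)) => //.
  by rewrite se big1 ?subr0 => [|t _]; [case: sV0 | rewrite scale0r].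
move=> x /uspan[b bV]; pose q := b t0 / a t0.
exists (fun t => if t == t0 then q else b t - q * a t).
have -> : \sum_(t | P t) (if t == t0 then q else b t - q * a t) *: upd s t =
    \sum_(t | P t) b t *: u t + q *: (s - \sum_(t | P t) a t *: u t).
  rewrite !(bigD1 t0 Pt0) /= /upd eqxx.
  rewrite (eq_bigr (fun t => b t *: u t - q *: (a t *: u t))); last first.
    by move=> t /andP[_ /negPf ->]; rewrite scalerBl scalerA.
  rewrite sumrB -scaler_sumr scalerBr scalerDr scalerA divfK //.
  rewrite opprD addrCA [b t0 *: _ + _]addrC -[RHS]addrA.
  by rewrite [q *: s + (- _ - _)]addrCA addNKr.
rewrite opprD addrA; apply: linear_subB => //; exact: linear_subZ.
Qed.

End LinearAlgebra.

(** * The base change of an algebra and its semilinear Galois action *)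

Section Tensor.
Variables (k K : fieldType) (i : {rmorphism k -> K}) (R : comAlgType k).
Variable RK : baseChangeAlg i R.
Local Notation j := (bca_inj RK).

Definition tensor_pred : {pred RK} := fun x =>
  `[< exists l : seq (K * R), x = \sum_(p <- l) p.1 *: j p.2 >].

Lemma tensor_pred_closed : subring_closed tensor_pred.
Proof.
split.
- apply/asboolP; exists [:: (1, 1)].
  by rewrite big_seq1 /= rmorph1 scale1r.
- move=> x y /asboolP[l ->] /asboolP[l' ->]; apply/asboolP.
  exists (l ++ [seq (- p.1, p.2) | p <- l']).
  rewrite big_cat big_map /= -sumrN; congr (_ + _).
  by apply: eq_bigr => p _; rewrite scaleNr.
- move=> x y /asboolP[l ->] /asboolP[l' ->]; apply/asboolP.
  exists [seq (p.1 * q.1, p.2 * q.2) | p <- l, q <- l'].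
  rewrite big_allpairs_dep big_distrl /=; apply: eq_bigr => p _.
  rewrite big_distrr /=; apply: eq_bigr => q _.
  by rewrite rmorphM -scalerAl -scalerAr scalerA.
Qed.

HB.instance Definition _ :=
  GRing.isSubringClosed.Build RK tensor_pred tensor_pred_closed.

Record tensor_sub := TensorSub {
  tensor_val : RK; _ : tensor_val \in tensor_pred }.

HB.instance Definition _ := [isSub for tensor_val].
HB.instance Definition _ := [Choice of tensor_sub by <:].
HB.instance Definition _ := [SubChoice_isSubComNzRing of tensor_sub by <:].

Lemma lift_tensor_sub (A : comPzRingType) (f : {rmorphism A -> RK}) :
  (forall a, f a \in tensor_pred) ->
  exists g : {rmorphism A -> tensor_sub}, forall a, tensor_val (g a) = f a.
Proof.
move=> fP; pose g a := TensorSub (fP a).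
have gB : zmod_morphism g by move=> a b; apply: val_inj; apply: rmorphB.
have gM : monoid_morphism g.
  by split=> [|a b]; apply: val_inj; [apply: rmorph1 | apply: rmorphM].
pose m1 := GRing.isZmodMorphism.Build A tensor_sub g gB.
pose m2 := GRing.isMonoidMorphism.Build A tensor_sub g gM.
by exists (HB.pack g m1 m2 : {rmorphism A -> tensor_sub}).
Qed.

(** The universal property maps [RK] into the subring of such combinations; followed by the
    inclusion, this map agrees with the identity on [R] and on [K], so it is the identity. *)
Lemma tensor_span (x : RK) :
  exists l : seq (K * R), x = \sum_(p <- l) p.1 *: j p.2.
Proof.
have [al alE] : exists g : {rmorphism R -> tensor_sub}, forall r, val (g r) = j r.
  apply: lift_tensor_sub => r; apply/asboolP; exists [:: (1, r)].
  by rewrite big_seq1 scale1r.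
have [be beE] : exists g : {rmorphism K -> tensor_sub}, forall c, val (g c) = c%:A.
  apply: (@lift_tensor_sub K (in_alg RK)) => c; apply/asboolP; exists [:: (c, 1)].
  by rewrite big_seq1 rmorph1.
have [albe uni] := bca_spec RK.
have [|gam [gamR gamK _]] := uni _ al be.
  by move=> a; apply: val_inj; rewrite [LHS]alE [RHS]beE albe.
have [|gam0 [_ _ gam0P]] := uni RK j (in_alg RK); first exact: albe.
have e1 : x = gam0 x by apply: (gam0P idfun).
have /(_ x) e2 : (val \o gam)%FUN =1 gam0.
  apply: (gam0P (val \o gam)%FUN) => [r|c] /=; first by rewrite gamR alE.
  by rewrite gamK beE.
by rewrite e1 -e2; apply/asboolP; apply: (valP (gam x)).
Qed.

Lemma galAlg_inj (g : galois i) r : galAlg RK g (j r) = j r.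
Proof. by rewrite /galAlg; case: cid => ga []. Qed.

Lemma galAlgZ (g : galois i) c x : galAlg RK g (c *: x) = g c *: galAlg RK g x.
Proof.
rewrite -mulr_algl rmorphM -[RHS]mulr_algl; congr (_ * _).
by rewrite /galAlg; case: cid => ga [].
Qed.

Lemma galAlg_sum (g : galois i) (l : seq (K * R)) :
  galAlg RK g (\sum_(p <- l) p.1 *: j p.2) = \sum_(p <- l) g p.1 *: j p.2.
Proof.
by rewrite rmorph_sum; apply: eq_bigr => p _; rewrite galAlgZ galAlg_inj.
Qed.

(** Galois elements are compared through their action on [K], not as records, so any [h] acting as
    the composite is allowed. *)
Lemma galAlg_comp (g g' h : galois i) x : (forall c, h c = g (g' c)) ->
  galAlg RK h x = galAlg RK g (galAlg RK g' x).
Proof.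
have [l ->] := tensor_span x => hE; rewrite !galAlg_sum rmorph_sum.
by apply: eq_bigr => p _; rewrite galAlgZ galAlg_inj hE.
Qed.

Lemma galAlg_eq_id (h : galois i) x : (forall c, h c = c) -> galAlg RK h x = x.
Proof.
have [l ->] := tensor_span x => hE; rewrite !galAlg_sum.
by apply: eq_bigr => p _; rewrite hE.
Qed.

Lemma galAlgVK (g : galois i) : cancel (galAlg RK g) (galAlg RK (galV g)).
Proof.
move=> x; rewrite -(galAlg_comp (h := galId i)); first exact: galAlg_eq_id.
by move=> c /=; rewrite gal_funK.
Qed.

Lemma galAlgKV (g : galois i) : cancel (galAlg RK (galV g)) (galAlg RK g).
Proof.
move=> x; rewrite -(galAlg_comp (h := galId i)); first exact: galAlg_eq_id.
by move=> c /=; rewrite gal_invK.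
Qed.

(** An element involves finitely many elements of [R], all Galois fixed. On the row of its
    coefficients the group acts coordinatewise, and fixed rows give fixed elements, even if these
    elements of [R] are dependent. *)
Lemma galois_descent (S : galois i -> Prop) (V : RK -> Prop) :
  linear_sub V -> (forall g, S g -> forall x, V x -> V (galAlg RK g x)) ->
  forall x, V x -> exists m (a : 'I_m -> K) (w : 'I_m -> RK),
    (forall l, V (w l) /\ forall g, S g -> galAlg RK g (w l) = w l) /\
    x = \sum_(l < m) a l *: w l.
Proof.
move=> sV stabV x; have [l ->] := tensor_span x.
pose r (t : 'I_(size l)) := (tnth (in_tuple l) t).2.
pose F (v : 'rV[K]_(size l)) := \sum_t v 0 t *: j (r t).
have FD a v w : F (a *: v + w) = a *: F v + F w.
  rewrite /F scaler_sumr -big_split; apply: eq_bigr => t _.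
  by rewrite !mxE scalerDl scalerA.
have F0 : F 0 = 0 by rewrite /F big1 // => t _; rewrite mxE scale0r.
have Fg g v : galAlg RK g (F v) = F (map_mx g v).
  rewrite rmorph_sum; apply: eq_bigr => t _.
  by rewrite galAlgZ galAlg_inj mxE.
have -> : \sum_(p <- l) p.1 *: j p.2 = F (\row_t (tnth (in_tuple l) t).1).
  by rewrite big_tnth; apply: eq_bigr => t _; rewrite mxE.
move=> VF.
pose G (h : {rmorphism K -> K}) := exists2 g : galois i, S g & gal_fun g = h.
have [|h [g Sg <-] v|m [a [w [wP wE]]]] :=
    @fixed_vectors_span K _ G (fun v => V (F v)) _ _ _ VF.
- by split=> [|a v w Vv Vw]; [rewrite F0; case: sV | rewrite FD; apply: sV.2].
- by rewrite -Fg; apply: stabV.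
exists m, a, (fun l' => F (w l')); split=> [l'|].
  have [Vw fw] := wP l'; split=> // g Sg; rewrite Fg fw //; by exists g.
rewrite wE; apply: (big_rec2 (fun v y => F v = y)) => // l' y z _ <-.
exact: FD.
Qed.

End Tensor.

(** * Cox rings *)

Section CoxRings.
Arguments cx_emb {K X M cl A} c {m} s : rename.
Variables (K : fieldType) (X : schemeOver K).
Hypotheses (intX : integral_scheme X) (hH0 : bijective (scal X)).
Variables (M : zmodType) (cl : M -> Pic X) (hM : pic_subgroup cl).
Variables (A : comAlgType K) (C : coxRing cl A).

Local Notation deg := (in_degree C).

Lemma cox_invertible m : invertible (C m).
Proof. exact: pic_mem_invertible (cs_class C m). Qed.

Lemma emb0 m : cx_emb C (0 : msec (C m) (openT X)) = 0.
Proof. by apply: (addrI (cx_emb C (0 : msec (C m) (openT X)))); rewrite -cx_embD !addr0. Qed.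

Lemma embN m (s : msec (C m) (openT X)) : cx_emb C (- s) = - cx_emb C s.
Proof. by apply/eqP; rewrite -addr_eq0 -cx_embD addNr emb0. Qed.

Lemma emb_eq0 m (s : msec (C m) (openT X)) : cx_emb C s = 0 -> s = 0.
Proof.
move=> s0; pose F := dfwith (fun m => 0 : msec (C m) (openT X)) s.
have := @cx_direct _ _ _ _ _ C [:: m] F isT.
rewrite big_seq1 /F dfwith_in => /(_ s0 m (mem_head _ _)).
by rewrite dfwith_in.
Qed.

Lemma emb_neq0 m (s : msec (C m) (openT X)) : cx_emb C s <> 0 -> s <> 0.
Proof. by move=> h s0; apply: h; rewrite s0 emb0. Qed.

Lemma emb_inj m : injective (fun s : msec (C m) (openT X) => cx_emb C s).
Proof.
move=> s t e; apply/eqP; rewrite -subr_eq0; apply/eqP/emb_eq0.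
by rewrite cx_embD embN e subrr.
Qed.

Lemma deg_sub m : linear_sub (deg m).
Proof.
split=> [|c _ _ [s ->] [t ->]]; first by exists 0; rewrite emb0.
by exists (scal X c *: s + t); rewrite cx_embD cx_embZ.
Qed.

Lemma degM m m' n f g : m + m' = n -> deg m f -> deg m' g -> deg n (f * g).
Proof.
by move=> e [s ->] [t ->]; exists (cs_mul C e (openT X) s t); rewrite cx_embM.
Qed.

Lemma deg_one : deg 0 1.
Proof. by exists (cs_one C); rewrite cx_emb1. Qed.

(** The unit section generates the sheaf of degree 0, and its coefficient is a global function, that
    is, a constant. *)
Lemma deg0P f : deg 0 f -> exists c, f = c%:A.
Proof.
move=> [s ->]; have [a ->] := gen_ex1 (@cs_one_gen _ _ _ _ C) s.
have [scalV _ scalK] := hH0; exists (scalV a).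
by rewrite -{1}(scalK a) cx_embZ cx_emb1.
Qed.

Lemma degM_neq0 m m' f g :
  deg m f -> deg m' g -> f <> 0 -> g <> 0 -> f * g <> 0.
Proof.
move=> [s ->] [t ->] /emb_neq0 s0 /emb_neq0 t0.
rewrite -(cx_embM (erefl (m + m'))) => /emb_eq0.
by apply: pairing_neq0 => //; [exact: cox_invertible.. | exact: cs_perfect].
Qed.

Lemma deg_direct (r : seq M) (F : M -> A) : (forall m, deg m (F m)) -> uniq r ->
  \sum_(m <- r) F m = 0 -> forall m, m \in r -> F m = 0.
Proof.
move=> degF ur F0 m mr.
pose s m := projT1 (cid (degF m)).
have sE m' : F m' = cx_emb C (s m') by rewrite /s; case: cid.
rewrite sE (@cx_direct _ _ _ _ _ C r s ur) ?emb0 // -[RHS]F0.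
by apply: eq_bigr.
Qed.

Lemma deg_uniq m m' f : deg m f -> deg m' f -> f <> 0 -> m = m'.
Proof.
move=> dm dm' f0; apply/eqP/contraT => mm'; case: f0.
pose F n := if n == m then f else if n == m' then - f else 0.
have := @deg_direct [:: m; m'] F _ _ _ m (mem_head _ _).
rewrite /F eqxx; apply.
- move=> n; case: eqP => [->|_] //; case: eqP => [->|_]; last by case: (deg_sub n).
  by rewrite -sub0r; apply: (linear_subB (deg_sub m')) => //; case: (deg_sub m').
- by rewrite /= inE mm'.
- by rewrite !big_cons big_nil eqxx eq_sym (negPf mm') eqxx addr0 subrr.
Qed.

(* A homogeneous unit trivializes the sheaf of its degree. *)
Lemma deg_pointed m f g : deg m f -> deg (- m) g -> f <> 0 -> g <> 0 -> m = 0.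
Proof.
move=> df dg f0 g0; have fg0 := degM_neq0 df dg f0 g0.
have /deg0P[c fgE] := degM (subrr m) df dg.
have c0 : c != 0 by apply/eqP => c0; apply: fg0; rewrite fgE c0 scale0r.
case: df dg fgE {f0 g0 fg0} => s -> [t ->].
rewrite -(cx_embM (subrr m)) -(cx_emb1 C) -cx_embZ => /emb_inj stE.
pose c1 V := res (@subT _ V) (scal X c); pose c2 V := res (@subT _ V) (scal X c^-1).
have c12 V : c1 V * c2 V = 1 by rewrite -rmorphM -rmorphM divff // !rmorph1.
have gs : is_gen s.
  move=> V h u.
  have [a aE] := gen_ex (@cs_one_gen _ _ _ _ C) h (cs_mul C (subrr m) V u (mres h t)).
  (* From [u t = a] and [s t = c] follows [a s = (u t) s = u (t s) = c u], so that [u] is [a s]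
     divided by [c]. *)
  have key : a *: mres h s = c1 V *: u.
    rewrite -[mres h s in LHS](cs_mul1 (add0r m) h) -pairZl -aE.
    rewrite (cs_mulA (subrr m) (addNr m) (add0r m) (addr0 m)).
    rewrite (cs_mulC (addNr m) (subrr m)) -pair_res stE mresZ pairZr.
    rewrite (cs_mulC (addr0 m) (add0r m)) cs_mul1; congr (_ *: _).
    exact: res_irr.
  exists (c2 V * a); split; first by rewrite -scalerA key scalerA mulrC c12 scale1r.
  move=> b uE.
  have bE : a = b * c1 V.
    apply: (gen_inj (@cs_one_gen _ _ _ _ C) (h := h)).
    rewrite -aE uE pairZl -pair_res stE mresZ scalerA; congr ((_ * _) *: _).
    exact: res_irr.
  by rewrite bE mulrCA [c2 V * _]mulrC c12 mulr1.
have [clI cl0 _] := hM; apply/esym/clI.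
exact: pic_eq cl0 (cs_class C m) (gen_sheaf_iso gs).
Qed.

Definition hdec (f : A) (F : M -> A) := (forall m, deg m (F m)) /\
  exists r, [/\ uniq r, (forall m, m \notin r -> F m = 0) & f = \sum_(m <- r) F m].

Lemma deg_muln m f n : deg m f -> deg m (f *+ n).
Proof.
move=> df; elim: n => [|n IHn]; first by rewrite mulr0n; case: (deg_sub m).
by rewrite mulrS; apply: linear_subD => //; apply: deg_sub.
Qed.

Lemma hdec_ex f : exists F, hdec f F.
Proof.
have [r [s ->]] := cx_span C f.
(* A degree may be repeated in [r], so its summand counts with multiplicity. *)
pose F m := cx_emb C (s m) *+ count_mem m r; exists F; split.
  by move=> m; apply: deg_muln; exists (s m).
exists (undup r); split; [exact: undup_uniq| |].
- by move=> m; rewrite mem_undup /F => /count_memPn ->; rewrite mulr0n.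
- rewrite -big_undup_iterop_count; apply: eq_bigr => m _.
  by rewrite Monoid.iteropE iter_addr_0.
Qed.

Lemma sum_uniq_supp (r r' : seq M) (F : M -> A) : uniq r -> uniq r' ->
  {subset r <= r'} -> (forall m, m \notin r -> F m = 0) ->
  \sum_(m <- r) F m = \sum_(m <- r') F m.
Proof.
move=> ur ur' rr' F0; rewrite [RHS](bigID (mem r)) /= [X in _ + X]big1 // addr0.
rewrite -[RHS]big_filter; apply: perm_big; apply: uniq_perm => //; first exact: filter_uniq.
move=> m; rewrite mem_filter /=; case: (boolP (m \in r)) => // mr.
by rewrite rr'.
Qed.

Lemma hdec_uniq f F G : hdec f F -> hdec f G -> F = G.
Proof.
move=> [dF [r [ur r0 fF]]] [dG [r' [ur' r0' fG]]]; apply: funext => m.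
pose l := undup (m :: r ++ r').
have ul : uniq l by apply: undup_uniq.
have rl : {subset r <= l}.
  by move=> x xr; rewrite mem_undup inE mem_cat xr !orbT.
have r'l : {subset r' <= l}.
  by move=> x xr; rewrite mem_undup inE mem_cat xr !orbT.
apply/eqP; rewrite -subr_eq0; apply/eqP.
apply: (@deg_direct l (fun m => F m - G m)) => //.
- by move=> n; apply: linear_subB => //; apply: deg_sub.
- by rewrite sumrB -(sum_uniq_supp ur ul rl r0) -fF -(sum_uniq_supp ur' ul r'l r0') -fG subrr.
- by rewrite mem_undup mem_head.
Qed.

Definition hcomp m f : A := projT1 (cid (hdec_ex f)) m.

Lemma hcomp_dec f : hdec f (hcomp^~ f).
Proof. by rewrite /hcomp; case: cid. Qed.

Lemma hcompE f F m : hdec f F -> hcomp m f = F m.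
Proof. by move=> fF; rewrite (hdec_uniq fF (hcomp_dec f)). Qed.

Lemma hcomp_deg m f : deg m (hcomp m f).
Proof. by have [] := hcomp_dec f. Qed.

Lemma hcompD m f g : hcomp m (f + g) = hcomp m f + hcomp m g.
Proof.
apply: (@hcompE _ (fun m => hcomp m f + hcomp m g)); split.
  by move=> n; apply: linear_subD; [exact: deg_sub | exact: hcomp_deg..].
have [_ [r [ur r0 fE]]] := hcomp_dec f; have [_ [r' [ur' r0' gE]]] := hcomp_dec g.
exists (undup (r ++ r')); split; first exact: undup_uniq.
  by move=> n; rewrite mem_undup mem_cat negb_or => /andP[/r0 -> /r0' ->]; rewrite addr0.
rewrite big_split {1}fE {1}gE.
by congr (_ + _); apply: sum_uniq_supp; rewrite ?undup_uniq // => n nr;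
  rewrite mem_undup mem_cat nr ?orbT.
Qed.

Lemma hcomp_id m f : deg m f -> hcomp m f = f.
Proof.
move=> df; rewrite (@hcompE _ (fun n => if n == m then f else 0)) ?eqxx //.
split=> [n|]; first by case: eqP => [->|_] //; case: (deg_sub n).
exists [:: m]; split=> // [n|]; last by rewrite big_seq1 eqxx.
by rewrite inE => /negPf ->.
Qed.

Lemma hcompMr m d f g : deg d g -> hcomp m (f * g) = hcomp (m - d) f * g.
Proof.
move=> dg; apply: (@hcompE _ (fun m => hcomp (m - d) f * g)); split.
  by move=> n; apply: (degM (subrK d n)) => //; apply: hcomp_deg.
have [_ [r [ur r0 fE]]] := hcomp_dec f.
exists [seq n + d | n <- r]; split.
- by rewrite map_inj_uniq //; apply: addIr.
- move=> n nr; rewrite r0 ?mul0r //; apply: contra nr => nr.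
  by apply/mapP; exists (n - d); rewrite ?subrK.
- by rewrite big_map {1}fE mulr_suml; apply: eq_bigr => n _; rewrite addrK.
Qed.

Lemma hcomp_sum m (n : nat) (f : 'I_n -> A) :
  hcomp m (\sum_j f j) = \sum_j hcomp m (f j).
Proof.
apply: (big_morph _ (hcompD m)).
by apply: hcomp_id; case: (deg_sub m).
Qed.

Lemma ideal_genP (n : nat) (f : 'I_n -> A) x :
  ideal_gen (range f) x <-> exists a : 'I_n -> A, x = \sum_j a j * f j.
Proof.
split=> [[p [a [b [bf ->]]]]|[a ->]]; last first.
  by exists n, a, f; split=> // j; exists j.
have /choice[t tE] : forall j, exists t, f t = b j.
  by move=> j; have [t _ <-] := bf j; exists t.
(* The same generator may occur several times; its coefficients are added up. *)
exists (fun l => \sum_(j < p | t j == l) a j).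
rewrite (partition_big t xpredT) //=; apply: eq_bigr => l _.
by rewrite mulr_suml; apply: eq_bigr => j /eqP <-; rewrite tE.
Qed.

(** The component of degree [d] of any expression of [x] is again an expression of [x]. *)
Lemma homog_comb (n : nat) (m : 'I_n -> M) (f : 'I_n -> A) d x :
  (forall j, deg (m j) (f j)) -> deg d x -> ideal_gen (range f) x ->
  exists a : 'I_n -> A, (forall j, deg (d - m j) (a j)) /\ x = \sum_j a j * f j.
Proof.
move=> df dx /ideal_genP[a xE].
exists (fun j => hcomp (d - m j) (a j)); split=> [j|]; first exact: hcomp_deg.
rewrite -{1}(hcomp_id dx) xE hcomp_sum.
by apply: eq_bigr => j _; apply: hcompMr.
Qed.

(** The degree of a nonzero homogeneous element and the section representing it are unique, so any
    presentation of [f] computes its divisor. *)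
Lemma defines_zero_div f D m (s : msec (C m) (openT X)) :
  defines C f D -> f = cx_emb C s -> D = zero_div s.
Proof.
move=> [f0 [m' [s' [fE' ->]]]] fE.
have e : m' = m by apply: (@deg_uniq m' m f) => //; [exists s' | exists s].
subst m'; suff -> : s' = s by [].
by apply: (@emb_inj m); rewrite -fE -fE'.
Qed.

Lemma defines_uniq f D D' : defines C f D -> defines C f D' -> D = D'.
Proof.
by move=> fD [f0 [m [s [fE ->]]]]; apply: defines_zero_div fD fE.
Qed.

Lemma defines_deg f D : defines C f D -> exists m, deg m f.
Proof. by move=> [_ [m [s [fE _]]]]; exists m, s. Qed.

Lemma deg_defines m f : deg m f -> f <> 0 -> exists D, defines C f D.
Proof. by move=> [s fE] f0; exists (zero_div s); split=> //; exists m, s. Qed.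

Lemma defines_class f D m : defines C f D -> deg m f -> div_class D (cl m).
Proof.
move=> fD [s fE]; rewrite (defines_zero_div fD fE).
apply: (div_class_zero_div intX (cox_invertible m)); last exact: cs_class.
by apply: emb_neq0; rewrite -fE; case: fD.
Qed.

Lemma defines_cartier f D : defines C f D -> eff_cartier D.
Proof.
move=> [f0 [m [s [fE ->]]]]; apply: (zero_div_cartier intX (cox_invertible m)).
by apply: emb_neq0; rewrite -fE.
Qed.

(** With homogeneous coefficients, membership in the ideal becomes an identity between sections of
    the sheaves, to which [zero_div_sum] applies. *)
Lemma defines_sum (n : nat) (f : 'I_n -> A) (H : 'I_n -> ideals X) g D :
  (forall j, defines C (f j) (H j)) -> defines C g D -> ideal_gen (range f) g ->
  forall U (c : sec U), D U c -> sum_ideals H c.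
Proof.
move=> fH [g0 [d [s [gE ->]]]] gf.
have /choice[m dm] : forall j, exists m, deg m (f j).
  by move=> j; apply: defines_deg (fH j).
have dg : deg d g by exists s.
have [a [da aE]] := homog_comb dm dg gf.
pose t j := projT1 (cid (dm j)); pose b j := projT1 (cid (da j)).
have tE j : f j = cx_emb C (t j) by rewrite /t; case: cid.
have bE j : a j = cx_emb C (b j) by rewrite /b; case: cid.
have -> : H = fun j => zero_div (t j).
  by apply: funext => j; apply: defines_zero_div (fH j) (tE j).
apply: (@zero_div_sum X intX n (C d) s (fun j => C (d - m j)) (fun j => C (m j))
  (fun j => cs_mul C (subrK (m j) d)) b t) => //.
- exact: cox_invertible.
- by move=> j; apply: cox_invertible.
- by apply: emb_neq0; rewrite -gE.
- by move=> j; apply: emb_neq0; rewrite -tE; case: (fH j).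
- apply: (@emb_inj d); rewrite -gE aE.
  rewrite (big_morph (fun s : msec (C d) (openT X) => cx_emb C s) (@cx_embD _ _ _ _ _ C d) (emb0 d)).
  by apply: eq_bigr => j _; rewrite cx_embM tE bE.
Qed.

End CoxRings.

(** * Galois-stable generators *)

Section Ideals.
Variables (K : fieldType) (A : comAlgType K) (n : nat) (f : 'I_n -> A).
Local Notation I := (ideal_gen (range f)).

Lemma ideal_gen_in j : I (f j).
Proof.
apply/ideal_genP; exists (fun l => (l == j)%:R).
rewrite (bigD1 j) //= eqxx mul1r big1 ?addr0 // => l /negPf ->.
by rewrite mul0r.
Qed.

Lemma ideal_genM a x : I x -> I (a * x).
Proof.
move=> /ideal_genP[b ->]; apply/ideal_genP; exists (fun j => a * b j).
by rewrite mulr_sumr; apply: eq_bigr => j _; rewrite mulrA.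
Qed.

Lemma ideal_gen_sub : linear_sub I.
Proof.
split=> [|c x y /ideal_genP[a ->] /ideal_genP[b ->]]; apply/ideal_genP.
  by exists (fun=> 0); rewrite big1 // => j _; rewrite mul0r.
exists (fun j => c *: a j + b j); rewrite scaler_sumr -big_split.
by apply: eq_bigr => j _; rewrite mulrDl scalerAl.
Qed.

End Ideals.

Section Descent.
Variables (k K : fieldType) (i : {rmorphism k -> K}) (Y : schemeOver k).
Variables (YK : baseChange i Y) (intYK : integral_scheme YK).
Hypothesis hH0 : bijective (scal YK).
Variables (M : zmodType) (cl : M -> Pic YK) (hM : pic_subgroup cl).
Hypothesis hMgal : forall (g : galois i) (m : M),
  exists m' : M, cl m' = pic_act g (cl m).
Variables (R : comAlgType k) (RK : baseChangeAlg i R) (C : coxRing cl RK).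
Hypothesis hC : galois_compatible C.

Local Notation deg := (in_degree C).
Local Notation gal := (galAlg RK).

Definition deg_act g m := projT1 (cid (hMgal g m)).

Lemma deg_actE g m : cl (deg_act g m) = pic_act g (cl m).
Proof. by rewrite /deg_act; case: cid. Qed.

Lemma gal_deg g m x : deg m x -> deg (deg_act g m) (gal g x).
Proof. by have [+ _] := hC g; apply; apply: deg_actE. Qed.

Lemma gal_neq0 g x : x <> 0 -> gal g x <> 0.
Proof. by move=> x0 gx; apply: x0; rewrite -(@galAlgVK _ _ _ _ RK g x) gx rmorph0. Qed.

Definition effective m := exists2 x, deg m x & x <> 0.

(** The degree of a nonzero element is unique, so the action on an effective degree can be read off
    on such an element. This spares comparing iterated direct images of sheaves. *)
Lemma deg_act_comp (g g' h : galois i) m : effective m -> (forall c, h c = g (g' c)) ->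
  deg_act h m = deg_act g (deg_act g' m).
Proof.
move=> [x dx x0] hE; apply: (deg_uniq (gal_deg h dx) _ (gal_neq0 (g := h) x0)).
by rewrite (galAlg_comp x hE); apply: gal_deg; apply: gal_deg.
Qed.

Lemma deg_act_id (h : galois i) m : effective m -> (forall c, h c = c) ->
  deg_act h m = m.
Proof.
move=> [x dx x0] hE; apply: (deg_uniq (gal_deg h dx) _ (gal_neq0 (g := h) x0)).
by rewrite galAlg_eq_id.
Qed.

Lemma deg_actVK g m : effective m -> deg_act (galV g) (deg_act g m) = m.
Proof.
move=> Em; rewrite -(deg_act_comp (h := galId i)) ?deg_act_id // => c.
by rewrite /= gal_funK.
Qed.

(** Conjugating a homogeneous element moves its divisor by [g], and a divisor containing the
    subscheme still does so afterwards, because the subscheme comes from [Y]. *)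
Lemma gal_cox_ideal (J : ideals Y) g x :
  cox_ideal C (inv_ideal (bc_proj YK) J) x ->
  cox_ideal C (inv_ideal (bc_proj YK) J) (gal g x).
Proof.
move=> [n [a [b [bP ->]]]]; exists n, (fun j => gal g (a j)), (fun j => gal g (b j)).
split; last by rewrite rmorph_sum; apply: eq_bigr => j _; rewrite rmorphM.
move=> j; have [D bD DI] := bP j.
exists (image_ideal (galMor YK g) D); first by have [_] := hC g; apply.
by move=> U a' /DI; apply: inv_ideal_galois.
Qed.

Section Generators.
Variables (s : nat) (d : 'I_s -> M) (f : 'I_s -> RK).
Hypotheses (df : forall j, deg (d j) (f j)) (f0 : forall j, f j <> 0).
Local Notation V := (ideal_gen (range f)).
Hypothesis galV_ideal : forall g x, V x -> V (gal g x).
(** Several blocks may carry the same degrees, so an index is determined by its degree only together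
    with its block. *)
Variable blk : 'I_s -> nat.
Hypothesis blk_act : forall g j, exists j', blk j' = blk j /\ d j' = deg_act g (d j).
Hypothesis blk_inj : forall j j', blk j = blk j' -> d j = d j' -> j = j'.

Lemma effective_d j : effective (d j).
Proof. by exists (f j). Qed.
#[local] Hint Resolve effective_d : core.

Definition deg_le j l := `[< exists2 x, deg (d l - d j) x & x <> 0 >].

Lemma deg_le_refl j : deg_le j j.
Proof. by apply/asboolP; exists 1; rewrite ?subrr; [exact: deg_one | exact/eqP/oner_neq0]. Qed.

Lemma deg_le_trans j l p : deg_le j l -> deg_le l p -> deg_le j p.
Proof.
move=> /asboolP[x dx x0] /asboolP[y dy y0]; apply/asboolP; exists (y * x).
  by apply: degM dy dx; rewrite addrA subrK.
exact: (degM_neq0 intYK dy dx).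
Qed.

Lemma deg_le_anti j l : deg_le j l -> deg_le l j -> d j = d l.
Proof.
move=> /asboolP[x dx x0] /asboolP[y dy y0]; apply/esym/eqP; rewrite -subr_eq0.
apply/eqP; apply: (deg_pointed intYK hH0 hM dx _ x0 y0).
by rewrite opprB.
Qed.

Definition deg_rank l := #|[set j | deg_le j l]%SET|.

(** Everything below [j] is below [l], while by antisymmetry [l] itself is not below [j]. The rank
    thus serves as induction measure. *)
Lemma deg_rank_lt j l : deg_le j l -> d j <> d l -> (deg_rank j < deg_rank l)%N.
Proof.
move=> jl djl; apply: proper_card; apply/properP; split.
  by apply/fintype.subsetP => p; rewrite !finset.in_set => pj; apply: deg_le_trans pj jl.
exists l; rewrite !finset.in_set ?deg_le_refl //; apply/negP => lj.
by apply: djl; apply: deg_le_anti.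
Qed.

(** A nonzero coefficient [a l] witnesses that [l] is below [r], so only generators of strictly
    smaller degree contribute. *)
Definition lower_part r (x : RK) := exists a : 'I_s -> RK,
  (forall l, deg (d r - d l) (a l)) /\ x = \sum_(l | d l != d r) a l * f l.

Lemma lower_part_sub r : linear_sub (lower_part r).
Proof.
split=> [|c _ _ [a [da ->]] [b [db ->]]].
  exists (fun=> 0); split=> [l|]; first by case: (deg_sub C (d r - d l)).
  by rewrite big1 // => l _; rewrite mul0r.
exists (fun l => c *: a l + b l); split=> [l|].
  by apply: (deg_sub C _).2.
rewrite scaler_sumr -big_split; apply: eq_bigr => l _.
by rewrite mulrDl scalerAl.
Qed.

(** Exchange in the degree [d r] part of the ideal, with the elements fixed under the stabilizer of
    [d r] as spanning set. The family [w] is indexed by all of ['I_s], but only the indices of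
    degree [d r] enter the spanning property. *)
Lemma fixed_generators r : exists w : 'I_s -> RK,
  (forall l, [/\ V (w l), deg (d r) (w l), w l <> 0 &
     forall g, deg_act g (d r) = d r -> gal g (w l) = w l]) /\
  forall x, V x -> deg (d r) x ->
    exists a : 'I_s -> K, lower_part r (x - \sum_(l | d l == d r) a l *: w l).
Proof.
pose Vr x := V x /\ deg (d r) x.
pose Sr x := Vr x /\ forall g, deg_act g (d r) = d r -> gal g x = x.
have sVr : linear_sub Vr.
  have sV := ideal_gen_sub f; have sD := deg_sub C (d r).
  split=> [|c x y [Vx dx] [Vy dy]]; first by split; [case: sV | case: sD].
  by split; [apply: sV.2 | apply: sD.2].
have span x : Vr x -> exists m (a : 'I_m -> K) (w : 'I_m -> RK),
    (forall l, Sr (w l)) /\ x = \sum_(l < m) a l *: w l.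
  move=> Vx; apply: (galois_descent (S := fun g => deg_act g (d r) = d r) sVr _ Vx).
  move=> g gr y [Vy dy]; split; first exact: galV_ideal.
  by rewrite -gr; apply: gal_deg.
have [||||w [wP wspan]] :=
    @exchange K RK Vr (lower_part r) Sr 'I_s [pred l | d l == d r] f sVr
      (lower_part_sub r).
- by move=> x [].
(* Since [f r] is nonzero and spanned by fixed elements, one of these is nonzero. *)
- have [m [a [w [wS fE]]]] := span (f r) (conj (ideal_gen_in f r) (df r)).
  apply: contrapT => nS; apply: (f0 (j := r)); rewrite fE big1 // => l _.
  suff -> : w l = 0 by rewrite scaler0.
  by apply: contrapT => wl0; apply: nS; exists (w l).
- exact: span.
(* Between equal degrees the coefficients have degree 0, so they are constants; the remaining terms
   make up the lower part. *)
- move=> x [Vx dx]; have [a [da ->]] := homog_comb df dx Vx.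
  have /choice[c cE] : forall l, exists c : K, d l == d r -> a l = c%:A.
    move=> l; have [dl|] := eqVneq (d l) (d r); last by exists 0.
    have := da l; rewrite dl subrr => /(deg0P hH0)[c cE]; by exists c.
  exists c, a; split=> //.
  rewrite (bigID [pred l | d l == d r]) /= addrC.
  rewrite [X in _ + X - _](eq_bigr (fun l => c l *: f l)) ?addrK // => l dl.
  by rewrite cE // mulr_algl.
exists w; split=> [l|x Vx dx]; first by have [[[]]] := wP l.
exact: wspan.
Qed.

(** Each new generator is transported from the representative [rho j] of its orbit of degrees,
    starting at the index [b j] of that degree in the block of [j]. Two transports to the same place
    differ by an element stabilizing the representative degree, which fixes the starting vector. *)
Lemma galois_stable_generators : exists f' : 'I_s -> RK,
  [/\ forall j, [/\ V (f' j), deg (d j) (f' j) & f' j <> 0],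
      forall j j' g, blk j = blk j' -> d j' = deg_act g (d j) ->
        gal g (f' j) = f' j' &
      forall j, ideal_gen (range f') (f j)].
Proof.
have /choice[w wP] := fixed_generators.
(* The relation ignores blocks, so that all generators of one degree are exchanged within the same
   family [w (rho j)]. *)
pose eqr j j' := `[< exists g, d j' = deg_act g (d j) >].
have eqr_refl j : eqr j j.
  by apply/asboolP; exists (galId i); rewrite deg_act_id.
have eqr_sym j j' : eqr j j' -> eqr j' j.
  move=> /asboolP[g gE]; apply/asboolP; exists (galV g).
  by rewrite gE deg_actVK.
have eqr_trans j j' j'' : eqr j j' -> eqr j' j'' -> eqr j j''.
  move=> /asboolP[g gE] /asboolP[g' gE']; apply/asboolP; exists (galM g' g).
  by rewrite gE' gE -(deg_act_comp (h := galM g' g)).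
pose rho j := choose (eqr j) j.
have rhoP j : eqr j (rho j) by apply: chooseP.
have rho_eq j j' : eqr j j' -> rho j = rho j'.
  move=> jj'; rewrite /rho -(choose_id (P := eqr j') (x0 := j)) //.
  - apply: eq_choose => l; apply/idP/idP; apply: eqr_trans => //; exact: eqr_sym.
  - exact: eqr_sym.
have rhoK j : rho (rho j) = rho j by apply/esym/rho_eq.
have /choice[b bP] : forall j, exists b, blk b = blk j /\ d b = d (rho j).
  by move=> j; have /asboolP[g ->] := rhoP j; apply: blk_act.
have /choice[h hE] : forall j, exists g, d j = deg_act g (d (rho j)).
  by move=> j; apply/asboolP; apply: eqr_sym.
pose f' j := gal (h j) (w (rho j) (b j)).
have f'E j j' g : blk j = blk j' -> d j' = deg_act g (d j) -> gal g (f' j) = f' j'.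
  move=> jj' gE; have rr : rho j = rho j' by apply: rho_eq; apply/asboolP; exists g.
  have bb : b j = b j'.
    have [b1 b2] := bP j; have [b1' b2'] := bP j'.
    by apply: blk_inj; rewrite ?b1 ?b1' // b2 b2' rr.
  have [_ _ _ fixw] := (wP (rho j')).1 (b j').
  (* Going out along [h j], then [g], and back along [h j'] stabilizes the representative degree. *)
  pose u := galM (galV (h j')) (galM g (h j)).
  rewrite /f' rr bb -[LHS](@galAlgKV _ _ _ _ RK (h j')); congr (gal _ _).
  rewrite -(@galAlg_comp _ _ _ _ RK g (h j) (galM g (h j))) //.
  rewrite -(@galAlg_comp _ _ _ _ RK _ _ u) //.
  apply: fixw; rewrite (@deg_act_comp (galV (h j')) (galM g (h j)) u) //.
  by rewrite (@deg_act_comp g (h j) (galM g (h j))) // -{1}rr -hE -gE (hE j') deg_actVK.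
exists f'; split=> // [j|j].
  have [Vw dw w0 _] := (wP (rho j)).1 (b j); split.
  - exact: galV_ideal.
  - by rewrite hE; apply: gal_deg.
  - exact: gal_neq0.
pose I' : RK -> Prop := ideal_gen (range f').
(* The induction concerns all elements of the ideal of degree [d j], not only [f j]: the conjugates
   of old generators met in the lower part are arbitrary such elements. *)
suff : forall m j x, (deg_rank j < m)%N -> V x -> deg (d j) x -> I' x.
  by apply=> //; apply: ideal_gen_in.
move=> {j}; elim=> // m IHm j x ltm Vx dx.
pose r := rho j; pose g := h j.
(* The element is moved to the representative degree, decomposed there, and moved back. *)
pose y := gal (galV g) x.
have Vy : V y by apply: galV_ideal.
have dy : deg (d r) y by rewrite -(deg_actVK g (effective_d r)) -hE; apply: gal_deg.
have [a [a' [da' yE]]] := (wP r).2 y Vy dy.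
have /(congr1 (gal g)) := yE; rewrite rmorphB galAlgKV => /eqP; rewrite subr_eq => /eqP ->.
have sI' : linear_sub I' := ideal_gen_sub f'.
apply: linear_subD => //; rewrite rmorph_sum; apply: linear_sub_sum => // l dl.
(* A lower term: the conjugate of [f l] lies in the ideal and has the degree of some [l'] strictly
   below [j]. *)
- rewrite rmorphM; have [a0|/eqP a0] := eqVneq (a' l) 0.
    by rewrite a0 rmorph0 mul0r; case: sI'.
  have [l' [_ l'E]] := blk_act g l.
  have dfl' : deg (d l') (gal g (f l)) by rewrite l'E; apply: gal_deg.
  apply: ideal_genM; apply: (IHm l') => //; last first.
    by apply: galV_ideal; apply: ideal_gen_in.
  rewrite -ltnS; apply: leq_trans ltm; rewrite ltnS; apply: deg_rank_lt.
    apply/asboolP; exists (gal g (a' l)); last exact: gal_neq0.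
    have dga := gal_deg g (da' l).
    suff -> : d j - d l' = deg_act g (d r - d l) by [].
    apply/eqP; rewrite subr_eq; apply/eqP.
    (* Additivity of the action on degrees is read off on the nonzero product [a' l * f l], whose
       conjugate has its degree computed in two ways. *)
    have af0 := degM_neq0 intYK (da' l) (df l) a0 (f0 (j := l)).
    apply: (@deg_uniq _ _ _ _ _ C _ _ (gal g (a' l * f l))).
    + by rewrite hE; apply: gal_deg; apply: degM (da' l) (df l); rewrite subrK.
    + by rewrite rmorphM; apply: degM dga dfl'.
    + exact: gal_neq0.
  move=> l'j; move/eqP: dl; apply.
  rewrite -(deg_actVK g (effective_d l)) -l'E l'j (hE j).
  by rewrite deg_actVK.
(* A term of the representative degree: there [w r l] is the new generator [f' l], and its conjugate
   is another new generator. *)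
- rewrite galAlgZ; apply: linear_subZ => //.
  have rl : rho l = r.
    rewrite -[RHS]rhoK; apply/esym/rho_eq/asboolP; exists (galId i).
    by rewrite deg_act_id // (eqP dl).
  have bl : b l = l.
    by have [b1 b2] := bP l; apply: blk_inj => //; rewrite b2 rl (eqP dl).
  have -> : w r l = f' l.
    have [_ _ _ fixw] := (wP r).1 l.
    by rewrite /f' rl bl fixw // -{1}rl -hE (eqP dl).
  have [l' [l'b l'E]] := blk_act g l.
  by rewrite (f'E l l' g) //; apply: ideal_gen_in.
Qed.

End Generators.
End Descent.

(** * Blocks of indices and cardinalities of orbits *)

Section Blocks.
Variables (n s : nat) (sb : nat -> nat).
Hypotheses (hsb0 : sb 0%N = 0%N) (hsbn : sb n = s).
Hypothesis hsb : forall l : nat, (l < n)%N -> (sb l < sb l.+1)%N.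

Lemma block_ex (j : 'I_s) : exists l, (l < n)%N /\ in_block sb l j.
Proof.
have ex : exists l, (j < sb l)%N by exists n; rewrite hsbn.
case: (ex_minnP ex) => -[|l]; first by rewrite hsb0.
move=> jl minl; exists l; split; first by apply: minl; rewrite hsbn.
by rewrite /in_block jl andbT leqNgt; apply/negP => /minl; rewrite ltnn.
Qed.

Lemma block_mono l l' : (l <= l' <= n)%N -> (sb l <= sb l')%N.
Proof.
elim: l' => [|l' IH]; first by rewrite leqn0 => /andP[/eqP ->].
move=> /andP[]; rewrite leq_eqVlt => /predU1P[-> //|]; rewrite ltnS => ll' l'n.
by apply: leq_trans (IH _) (ltnW (hsb l'n)); rewrite ll' ltnW.
Qed.

Lemma block_uniq (j : 'I_s) l l' : (l < n)%N -> (l' < n)%N ->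
  in_block sb l j -> in_block sb l' j -> l = l'.
Proof.
wlog: l l' / (l <= l')%N => [wl|].
  by case/orP: (leq_total l l') => h *; [apply: wl | apply/esym/wl].
rewrite leq_eqVlt => /predU1P[//|ll'] _ l'n /andP[_ jl] /andP[l'j _].
have /(leq_trans jl) : (sb l.+1 <= sb l')%N by apply: block_mono; rewrite ll' ltnW.
by rewrite ltnNge l'j.
Qed.

(** A choice of an index for each class is an injection into the block, which has no more indices
    than there are classes; so it hits every index. *)
Lemma block_inj (T : Type) (c : 'I_s -> T) l : (l < n)%N ->
  has_card (fun t => exists j, in_block sb l j /\ c j = t) (sb l.+1 - sb l) ->
  forall j j' : 'I_s, in_block sb l j -> in_block sb l j' -> c j = c j' -> j = j'.
Proof.
move=> ln [e [injE eP]] j j' bj bj' cc.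
have /choice[q qP] : forall u, exists j, in_block sb l j /\ c j = e u.
  by move=> u; apply/eP; exists u.
have injq : injective q.
  by move=> u u' /(congr1 c); rewrite (qP u).2 (qP u').2 => /injE.
pose B := [set j : 'I_s | (sb l <= j < sb l.+1)%N]%SET.
have cardB : (#|B| <= sb l.+1 - sb l)%N.
  have := hsb ln; rewrite -subn_gt0; case N: (sb l.+1 - sb l)%N => [//|N'] _.
  pose r (j : 'I_s) : 'I_N'.+1 := inord (j - sb l).
  suff injr : {in B &, injective r}.
    by rewrite -(card_in_imset injr) -[X in (_ <= X)%N]card_ord max_card.
  move=> x y; rewrite !finset.in_set => /andP[x1 x2] /andP[y1 y2].
  move=> /(congr1 val); rewrite /= !inordK; first last.
  - by rewrite -N ltn_sub2r // (leq_ltn_trans x1 x2).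
  - by rewrite -N ltn_sub2r // (leq_ltn_trans y1 y2).
  by move=> xy; apply: ord_inj; rewrite -(subnK x1) xy subnK.
have imB : q @: [set: 'I_(sb l.+1 - sb l)]%SET = B.
  apply/eqP; rewrite eqEcard card_imset // cardsT card_ord cardB andbT.
  apply/fintype.subsetP => x /imsetP[u _ ->]; rewrite finset.in_set.
  by have [] := qP u.
have im x : in_block sb l x -> exists u, x = q u.
  move=> bx; have : x \in B by rewrite finset.in_set.
  by rewrite -imB => /imsetP[u _ ->]; exists u.
have [u ju] := im j bj; have [u' ju'] := im j' bj'.
by move: cc; rewrite ju ju' (qP u).2 (qP u').2 => /injE ->.
Qed.

End Blocks.

Theorem theorem2p4
  (k K : fieldType) (i : {rmorphism k -> K}) (hK : separable_closure i)
  (Y : schemeOver k) (hY : variety Y) (hYint : geometrically_integral Y)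
  (YK : baseChange i Y) (hH0 : bijective (scal YK))
  (M : zmodType) (cl : M -> Pic YK) (hM : pic_subgroup cl)
  (hMfg : finitely_generated M)
  (hMgal : forall (g : galois i) (m : M),
     exists m' : M, cl m' = pic_act g (cl m))
  (R : comAlgType k) (RK : baseChangeAlg i R) (C : coxRing cl RK)
  (hC : galois_compatible C)
  (J : ideals Y) (hJ : closed_subscheme J)
  (s : nat) (H : 'I_s -> ideals YK) (f : 'I_s -> RK)
  (hX : strict_complete_intersection C (inv_ideal (bc_proj YK) J) H f)
  (c : 'I_s -> Pic YK) (hc : forall j : 'I_s, div_class (H j) (c j))
  (n : nat) (sb : nat -> nat) (hsb0 : sb 0%N = 0%N) (hsbn : sb n = s)
  (hsb : forall l : nat, (l < n)%N -> (sb l < sb l.+1)%N)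
  (horb : forall l : nat, (l < n)%N ->
     let P := fun a : Pic YK => exists j : 'I_s, in_block sb l j /\ c j = a in
     is_orbit (@pic_act k K i Y YK) P /\ has_card P (sb l.+1 - sb l)) :
  exists H' : 'I_s -> ideals YK,
    [/\ complete_intersection (inv_ideal (bc_proj YK) J) H',
        (forall l : nat, (l < n)%N ->
           is_orbit (fun g : galois i => image_ideal (galMor YK g))
             (fun D => exists j : 'I_s, in_block sb l j /\ H' j = D)) &
        (forall j : 'I_s, div_class (H' j) (c j))].
Proof.
have intYK := hYint K i YK (bc_proj YK) (bc_spec YK).
set I := inv_ideal (bc_proj YK) J in hX *.
have [defH [cartH dims IH] coxI] := hX.
have /choice[d df] : forall j, exists m, in_degree C m (f j).
  by move=> j; apply: defines_deg (defH j).
have f0 j : f j <> 0 by case: (defH j).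
(* The zero divisor of [f j] has the class of its degree, and an effective Cartier divisor has only
   one class. *)
have cd j : cl (d j) = c j.
  apply: (div_class_uniq (cartH j) _ (hc j)).
  exact: (defines_class intYK (defH j) (df j)).
have [clI _ _] := hM.
have /choice[blk blkP] := block_ex hsb0 hsbn.
have in_blk j l : (l < n)%N -> in_block sb l j -> blk j = l.
  by move=> ln jl; have [bn jb] := blkP j; apply: (block_uniq hsb bn ln jb jl).
(* The base point of the orbit belongs to it by the identity, so it is the class of some index of
   the block. *)
have base l : (l < n)%N -> exists j0, in_block sb l j0 /\
    forall a, (exists j, in_block sb l j /\ c j = a) <->
      exists g : galois i, a = pic_act g (c j0).
  move=> ln; have [[t tP] _] := horb _ ln.
  have [|j0 [bj0 ct]] := (tP t).2; first by exists (galId i); rewrite pic_act_id.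
  by exists j0; split=> // a; rewrite ct.
have dE g j0 j : c j = pic_act g (c j0) -> d j = deg_act hMgal g (d j0).
  by move=> e; apply: clI; rewrite deg_actE !cd.
have effd j : effective C (d j) by exists (f j).
have blk_act g j : exists j', blk j' = blk j /\ d j' = deg_act hMgal g (d j).
  have [ln bj] := blkP j; have [j0 [bj0 orb]] := base _ ln.
  have [|g0 g0E] := (orb (c j)).1; first by exists j.
  have [|j' [bj' j'E]] := (orb (pic_act (galM g g0) (c j0))).2.
    by exists (galM g g0).
  exists j'; split; first exact: in_blk.
  by rewrite (dE _ _ _ j'E) (dE _ _ _ g0E); apply: (deg_act_comp hMgal hC).
have blk_inj j j' : blk j = blk j' -> d j = d j' -> j = j'.
  move=> bb dd; have [ln bj] := blkP j; have [_ bj'] := blkP j'.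
  have [_ card] := horb _ ln.
  by apply: (block_inj hsb ln card bj); rewrite ?bb // -!cd dd.
(* By strictness this ideal is the Cox ideal of a subscheme coming from [Y]. *)
have galI g x : ideal_gen (range f) x -> ideal_gen (range f) (galAlg RK g x).
  by rewrite -coxI; apply: gal_cox_ideal.
have [f' [f'P f'gal f'gen]] := galois_stable_generators
  intYK hH0 hM hC df f0 galI blk_act blk_inj.
have /choice[H' defH'] : forall j, exists D, defines C (f' j) D.
  by move=> j; have [_ df' f'0] := f'P j; apply: deg_defines df' f'0.
have cartH' j : eff_cartier (H' j) by apply: (defines_cartier intYK (defH' j)).
(* Each family of generators lies in the ideal generated by the other, so each sum of ideal sheaves
   contains the divisors of the other family. *)
have HH' U (a : sec U) : sum_ideals H a <-> sum_ideals H' a.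
  split; apply: sum_ideals_min.
  - by apply: sum_ideals_ideal => j; case: (cartH' j).
  - by move=> j; apply: (defines_sum intYK defH' (defH j)).
  - by apply: sum_ideals_ideal => j; case: (cartH j).
  - move=> j; apply: (defines_sum intYK defH (defH' j)).
    by have [] := f'P j.
(* The divisor of a conjugate is the conjugate of the divisor, and a homogeneous element determines
   its divisor. *)
have galH' g j j' : blk j = blk j' -> c j' = pic_act g (c j) ->
    H' j' = image_ideal (galMor YK g) (H' j).
  move=> bb cc; have fg := f'gal _ _ _ bb (dE _ _ _ cc).
  apply: (defines_uniq (defH' j')); rewrite -fg.
  by have [_] := hC g; apply.
exists H'; split.
- split=> //; rewrite IH; apply: functional_extensionality_dep => U.
  by apply/seteqP; split=> a /HH'.
- move=> l ln; have [j0 [bj0 orb]] := base l ln.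
  exists (H' j0) => D; split.
  + move=> [j [bj <-]]; have [|g gE] := (orb (c j)).1; first by exists j.
    by exists g; apply: galH' => //; rewrite !(in_blk _ l).
  + move=> [g ->]; have [|j [bj jE]] := (orb (pic_act g (c j0))).2.
      by exists g.
    by exists j; split=> //; apply: galH' => //; rewrite !(in_blk _ l).
- move=> j; rewrite -cd; have [_ df' _] := f'P j.
  exact: (defines_class intYK (defH' j) df').
Qed.
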